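(* Let $\Gamma=\langle x,\gamma\rangle\le W$ be the Gupta–Sidki group, where $x$ is the rigid $3$-cycle and $\gamma=(\gamma,x,x^{-1})$. Let $U=\langle\Delta^n(x):n\ge1\rangle$ and $V=\{1,\tau_1,\tau_2,\tau_3\}$ with $\tau_1=\Delta(\tau_1)t$, $\tau_2=\Delta(\tau_3)$, $\tau_3=\Delta(\tau_2)t$, so that $\mathrm{Aut}(\Gamma)=\Gamma:U:V$ as a subgroup of $W$. Set $T=\langle\partial\Delta^{2n+1}(x):n\ge0\rangle$, a countably infinite elementary abelian $3$-group. Then $\mathrm{Aut}^2(\Gamma)=\mathrm{Aut}(\Gamma):T$ (split extension), $T$ centralizes $U$ and $V$, and $\mathrm{Aut}^3(\Gamma)=\mathrm{Aut}^2(\Gamma)$. In particular $\Gamma$ has height $2$.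
   Context: $W$ is the isometry group of the ternary rooted tree $X^*$, $X=\{0,1,2\}$. Elements are written $(g_0,g_1,g_2)\pi$ with $\pi\in\mathrm{Sym}(X)$, meaning $(yw)^{(g_0,g_1,g_2)\pi}=y^\pi w^{g_y}$. $x$ is the isometry $(1,1,1)(0\,1\,2)$ and $t=(1,1,1)(1\,2)$. For $g\in W$: $\Delta g=(g,g,g)$, $\partial g=(1,g,g^{-1})$, and iterates $\Delta^n$, $\partial\Delta^{n}g=\partial(\Delta^n g)$. The automorphism tower $\mathrm{Aut}^i(\Gamma)$ is realized inside $W$ as the normalizer tower of $\Gamma$ in $W$ (automorphisms acting by conjugation); in particular $\mathrm{Aut}(\Gamma)$ is the subgroup $\Gamma UV$ of $W$. $A:B$ denotes a split extension of $A$ by $B$. The height is the least $\alpha$ with $\mathrm{Aut}^\alpha=\mathrm{Aut}^{\alpha+1}$. *)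

(* Defs.v *)
From mathcomp Require Import all_boot all_fingroup.
Set Implicit Arguments. Unset Strict Implicit. Unset Printing Implicit Defensive.

Definition W := seq 'I_3 -> {perm 'I_3}.

Fixpoint act (g : W) (v : seq 'I_3) : seq 'I_3 :=
  match v with
  | [::] => [::]
  | y :: w => (g [::] y) :: act (fun u => g (y :: u)) w
  end.

Fixpoint actinv (g : W) (v : seq 'I_3) : seq 'I_3 :=
  match v with
  | [::] => [::]
  | y :: w => let y' := ((g [::])^-1)%g y in
              y' :: actinv (fun u => g (y' :: u)) w
  end.

(* group law on W: (v)^(g h) = ((v)^g)^h  (right actions, as in the paper) *)
Definition wone : W := fun _ => 1%g.
Definition wmul (g h : W) : W := fun v => (g v * h (act g v))%g.
Definition winv (g : W) : W := fun v => ((g (actinv g v))^-1)%g.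

Definition tri (g0 g1 g2 : W) (p : {perm 'I_3}) : W :=
  fun v => match v with
           | [::] => p
           | y :: w => (if nat_of_ord y == 0 then g0
                        else if nat_of_ord y == 1 then g1 else g2) w
           end.

Definition o0 : 'I_3 := ord0.
Definition o1 : 'I_3 := inord 1.
Definition o2 : 'I_3 := inord 2.

(* the 3-cycle (0 1 2) : 0->1->2->0 (mathcomp: (s*t) i = t (s i)) *)
Definition cyc : {perm 'I_3} := (tperm o1 o2 * tperm o0 o1)%g.
Definition tr12 : {perm 'I_3} := tperm o1 o2.

Definition x : W := tri wone wone wone cyc.
Definition t : W := tri wone wone wone tr12.

Definition Delta (g : W) : W := tri g g g 1%g.
Definition Partial (g : W) : W := tri wone g (winv g) 1%g.
Definition DeltaN (n : nat) (g : W) : W := iter n Delta g.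

Fixpoint gamma (v : seq 'I_3) : {perm 'I_3} :=
  match v with
  | [::] => 1%g
  | y :: w => if nat_of_ord y == 0 then gamma w
              else if nat_of_ord y == 1 then x w else winv x w
  end.

(* tau_1 = Delta(tau_1) t, tau_2 = Delta(tau_3), tau_3 = Delta(tau_2) t;
   index i in {1,2,3} *)
Fixpoint tau (i : nat) (v : seq 'I_3) : {perm 'I_3} :=
  match v with
  | [::] => if i == 2 then 1%g else tr12
  | _ :: w => tau (if i == 2 then 3 else if i == 3 then 2 else 1) w
  end.

Definition wset := W -> Prop.
Definition seteq (A B : wset) : Prop := forall g, A g <-> B g.
Definition is_subgroup (H : wset) : Prop :=
  H wone /\ (forall g h, H g -> H h -> H (wmul g h)) /\ (forall g, H g -> H (winv g)).
Definition gen (S : wset) : wset :=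
  fun g => forall H, is_subgroup H -> (forall s, S s -> H s) -> H g.
Definition setmul (A B : wset) : wset :=
  fun g => exists a b, A a /\ B b /\ g = wmul a b.
Definition normalizer (H : wset) : wset :=
  fun g => forall h, H h <-> H (wmul (wmul (winv g) h) g).
Definition is_normal (H G : wset) : Prop :=
  (forall h, H h -> G h) /\ (forall g h, G g -> H h -> H (wmul (wmul (winv g) h) g)).

Definition Gamma : wset := gen (fun g => g = x \/ g = gamma).
Definition U : wset := gen (fun g => exists n, 1 <= n /\ g = DeltaN n x).
Definition V : wset := fun g => g = wone \/ g = tau 1 \/ g = tau 2 \/ g = tau 3.
Definition T : wset := gen (fun g => exists n, g = Partial (DeltaN (2 * n + 1) x)).

(* automorphism tower realized as the normalizer tower in W *)
Fixpoint AutTower (n : nat) : wset :=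
  match n with 0 => Gamma | k.+1 => normalizer (AutTower k) end.

Definition split_ext (A N K : wset) : Prop :=
  is_normal N A /\ (forall g, K g -> A g) /\ seteq A (setmul N K) /\
  (forall g, N g -> K g -> g = wone).

Definition height_is (n : nat) : Prop :=
  seteq (AutTower n) (AutTower n.+1) /\ (forall m, m < n -> ~ seteq (AutTower m) (AutTower m.+1)).

Definition centralizes (A B : wset) : Prop :=
  forall a b, A a -> B b -> wmul a b = wmul b a.

Fixpoint inlist (g : W) (l : list W) : Prop :=
  match l with nil => False | cons h l' => h = g \/ inlist g l' end.
Definition finite_set (A : wset) : Prop := exists l : list W, forall g, A g -> inlist g l.

(* Main.v *)
(* Let B = Gamma U and let U^ be the abelian group generated by all Delta^n x, n >= 0.  Modulo
   Gamma', an element of B is determined by its exponents of gamma and of the Delta^n x, which can be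
   read off finitely many levels of its portrait, and an element of B with trivial root is described
   by linear relations between the exponents of its three sections (they are arbitrary modulo these,
   because Gamma contains Gamma' x Gamma' x Gamma').

   Multiplying by powers of x and by tau_1, an element normalizing one of the groups S in {Gamma,
   B, B T} may be assumed to fix the first level.  The sections g_i of such a g normalize Gamma or
   B, and x^g in S shows that the g_i are congruent modulo B; multiplying by Gamma one may assume
   g_i = h w_i with w_i in U^.  The condition x^g in S then restricts the w_i: w_i = 1 for S = Gamma,
   and (w_i) = (1, w, w^-1), i.e. g = Delta(h) d(w), for S = B.

   For S = Gamma this gives a recursion g -> h.  If h acts trivially on Gamma/Gamma', the word
   lengths of gamma^h and x^h decrease, whence h in Gamma U; otherwise h tau_3 acts trivially.
   For S = B, the condition gamma^g in S forces h to normalize Gamma, so g in Gamma U V d(w), and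
   normalizing tau_2 kills the even exponents of w, so that d(w) is in T.  For S = B T, the exponent
   conditions leave g = (d(y), d(y) w_1, d(y) w_2) up to Gamma U V, with the odd exponents of y
   trivial; its commutators with tau_1 and tau_2 then give w_1 w_2 = 1 and y = 1.  Finally B and B T
   are generated by elements of order 3 and have quotient V of exponent 2, so they are preserved by
   the normalizers of Gamma U V and Gamma U V T. *)

Require Import Defs.
From HB Require Import structures.
From mathcomp Require Import all_boot all_fingroup ssralg zmodp ring zify.
From mathcomp Require Import boolp.
Import Defs.
Set Implicit Arguments. Unset Strict Implicit. Unset Printing Implicit Defensive.
Import GRing.Theory.
Local Open Scope group_scope.

(** * The group of isometries of the tree *)

Definition rt (g : W) : {perm 'I_3} := g [::].
Definition sec (g : W) (i : 'I_3) : W := fun v => g (i :: v).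
Definition mk (f : 'I_3 -> W) (p : {perm 'I_3}) : W :=
  fun v => if v is i :: w then f i w else p.

Lemma Wext (g h : W) : rt g = rt h -> (forall i, sec g i = sec h i) -> g = h.
Proof. by move=> e0 es; apply/funext => -[//|i v]; exact: (congr1 (@^~ v) (es i)). Qed.

Lemma act_one v : act wone v = v.
Proof. by elim: v => //= y v IH; rewrite perm1 (_ : (fun _ => _) = wone) // IH. Qed.

Lemma act_mul g h v : act (wmul g h) v = act h (act g v).
Proof.
elim: v g h => //= y v IH g h; congr (_ :: _); first by rewrite permM.
by rewrite -IH.
Qed.

Lemma actinv_act g v : actinv g (act g v) = v.
Proof. by elim: v g => //= y v IH g; rewrite permK IH. Qed.

Lemma wmulA : associative wmul.
Proof. by move=> g h k; apply/funext => v; rewrite /wmul mulgA act_mul. Qed.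

Lemma wmul1g : left_id wone wmul.
Proof. by move=> g; apply/funext => v; rewrite /wmul act_one mul1g. Qed.

Lemma wmulVg : left_inverse wone winv wmul.
Proof.
move=> g; apply/funext => v; rewrite /wmul.
suff -> : act (winv g) v = actinv g v by rewrite /winv mulVg.
elim: v g => //= y v IH g; congr (_ :: _).
by rewrite -IH.
Qed.

Lemma wmulgV : right_inverse wone winv wmul.
Proof. by move=> g; apply/funext => v; rewrite /wmul /winv actinv_act mulgV. Qed.

Lemma wmulg1 : right_id wone wmul.
Proof. by move=> g; rewrite -(wmulVg g) wmulA wmulgV wmul1g. Qed.

(** Classical equality and choice make [W] a group in the sense of the library, which gives access
    to powers, conjugates and commutators. *)
HB.instance Definition _ := gen_eqMixin W.
HB.instance Definition _ := gen_choiceMixin W.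
HB.instance Definition _ := isGroup.Build W wmulA wmul1g wmulg1 wmulVg wmulgV.

Lemma wmulE (g h : W) : wmul g h = g * h. Proof. by []. Qed.
Lemma winvE (g : W) : winv g = g^-1. Proof. by []. Qed.
Lemma rtM (g h : W) : rt (g * h) = rt g * rt h. Proof. by []. Qed.
Lemma rt1 : rt 1 = 1. Proof. by []. Qed.
Lemma rtV (g : W) : rt g^-1 = (rt g)^-1. Proof. by []. Qed.
Lemma secM (g h : W) i : sec (g * h) i = sec g i * sec h (rt g i). Proof. by []. Qed.
Lemma sec1 i : sec 1 i = 1. Proof. by []. Qed.
Lemma secV (g : W) i : sec g^-1 i = (sec g ((rt g)^-1 i))^-1. Proof. by []. Qed.

Lemma rt_mk f p : rt (mk f p) = p. Proof. by []. Qed.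
Lemma sec_mk f p i : sec (mk f p) i = f i. Proof. by []. Qed.

(** The alphabet is read as F_3: [cyc] becomes translation by 1 and [tr12] negation, so identities
    between letters become linear equations. *)
Lemma I3P (P : 'Z_3 -> Prop) : P 0%R -> P 1%R -> P 2%:R%R -> forall i, P i.
Proof.
move=> P0 P1 P2 [[|[|[|//]]] lti].
- by rewrite (_ : Ordinal lti = 0%R) //; apply: val_inj.
- by rewrite (_ : Ordinal lti = 1%R) //; apply: val_inj.
- by rewrite (_ : Ordinal lti = 2%:R%R) //; apply: val_inj.
Qed.

Lemma o0E : o0 = 0%R :> 'Z_3. Proof. exact: val_inj. Qed.
Lemma o1E : o1 = 1%R :> 'Z_3. Proof. by apply: val_inj; rewrite /= inordK. Qed.
Lemma o2E : o2 = 2%:R%R :> 'Z_3. Proof. by apply: val_inj; rewrite /= inordK. Qed.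
Definition oE := (o0E, o1E, o2E).

Ltac z3eval := solve
  [ apply/eqP; vm_compute; reflexivity
  | by []
  | match goal with H : _ = _ |- _ => exfalso; move/eqP: H; vm_compute; discriminate end ].
Ltac z3case := repeat match goal with z : _ |- _ => let _ := constr:(z : 'I_3) in move: (z : 'Z_3); clear z end.
(* Decides (in)equations over F_3 by enumeration of the variables of the context. *)
Ltac z3 := intros; repeat match goal with H : @eq _ _ _ |- _ => revert H end;
  z3case; repeat (refine (I3P _ _ _)); intros; z3eval.

Lemma cycE (i : 'Z_3) : cyc i = (i + 1)%R.
Proof. by move: i; apply: I3P; rewrite /cyc !oE !permE /= ?permE; z3. Qed.

Lemma tr12E (i : 'Z_3) : tr12 i = (- i)%R.
Proof. by move: i; apply: I3P; rewrite /tr12 !oE permE; z3. Qed.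

Lemma cycX n (i : 'Z_3) : (cyc ^+ n) i = (i + n%:R)%R.
Proof.
elim: n i => [|n IH] i; first by rewrite perm1 addr0.
by rewrite expgSr permM IH cycE -addrA -natr1.
Qed.

(** The casts expose the type [W], and with it the group structure, which the arrow types of the
    fixpoints hide. *)
Notation gam := (gamma : W) (only parsing).
Notation ta i := (tau i : W) (only parsing).

(** The even permutations of three letters are the translations of F_3. *)
Definition even (p : {perm 'I_3}) := forall i : 'Z_3, p i = (i + p 0%R)%R.

Lemma even1 : even 1. Proof. by move=> i; rewrite !perm1 addr0. Qed.

Lemma evenM p q : even p -> even q -> even (p * q).
Proof. by move=> ep eq i; rewrite !permM ep eq [in RHS]eq addrA. Qed.

Lemma evenV p : even p -> even p^-1.
Proof.
move=> ep i; apply: (@perm_inj _ p); rewrite permKV ep.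
have := ep (p^-1 0%R); rewrite permKV => e; rewrite -addrA.
by rewrite -[X in (_ + X)%R]e addr0.
Qed.

Lemma even_cyc : even cyc. Proof. by move=> i; rewrite !cycE add0r. Qed.

Lemma even_tr12 : ~ even tr12.
Proof. by move=> /(_ 1%R); rewrite !tr12E; z3. Qed.

Lemma even_eq1 p : even p -> p 0%R = 0%R :> 'Z_3 -> p = 1.
Proof. by move=> ep p0; apply/permP => i; rewrite perm1 ep p0 addr0. Qed.

Lemma perm3_cases (p : {perm 'I_3}) :
  exists n, p * cyc ^+ n = 1 \/ p * cyc ^+ n * tr12 = 1.
Proof.
pose n := (- (p 0%R : 'Z_3))%R : 'Z_3; exists n; set q := p * _.
have q0 : q 0%R = 0%R by rewrite /q permM cycX natr_Zp subrr.
have [q1|q1] : q 1%R = 1%R \/ q 1%R = 2%:R%R.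
  have: q 1%R <> q 0%R by move/perm_inj.
  by rewrite q0; move: (q 1%R); apply: I3P => [/(_ erefl)//|_|_]; [left | right].
- left; apply/permP; apply: I3P; rewrite perm1 //.
  have: q 2%:R%R <> q 0%R by move/perm_inj.
  have: q 2%:R%R <> q 1%R by move/perm_inj.
  by rewrite q0 q1; move: (q 2%:R%R); apply: I3P.
- right; apply/permP; apply: I3P; rewrite permM perm1 tr12E ?q0 ?q1; try z3.
  have: q 2%:R%R <> q 0%R by move/perm_inj.
  have: q 2%:R%R <> q 1%R by move/perm_inj.
  by rewrite q0 q1; move: (q 2%:R%R); apply: I3P => // _ _; z3.
Qed.

(** Coinduction for elements given by recursion on their sections. The second disjunct lets a
    section leave the relation once equality is known there. *)
Lemma bisim (R : W -> W -> Prop) :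
  (forall g h, R g h -> rt g = rt h /\
     forall i, R (sec g i) (sec h i) \/ sec g i = sec h i) ->
  forall g h, R g h -> g = h.
Proof.
move=> RP g h Rgh; apply/funext => v; elim: v g h Rgh => [|i v IH] g h /RP[e es] //.
by case: (es i) => [/IH //|/(congr1 (@^~ v))].
Qed.

Lemma secJ (g h : W) i : rt h = 1 ->
  sec (g ^ h) i = (sec h i)^-1 * (sec g i * sec h (rt g i)).
Proof. by move=> h1; rewrite /conjg !secM rtV secV h1 invg1 !perm1. Qed.

Lemma secJ1 (g h : W) i : rt g = 1 -> rt h = 1 -> sec (g ^ h) i = sec g i ^ sec h i.
Proof. by move=> g1 h1; rewrite secJ // g1 perm1. Qed.

Lemma rtJ (g h : W) : rt (g ^ h) = rt g ^ rt h. Proof. by []. Qed.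

Lemma rtX (g : W) n : rt (g ^+ n) = rt g ^+ n.
Proof. by elim: n => // n IH; rewrite !expgS rtM IH. Qed.

Lemma secX (g : W) n i : rt g = 1 -> sec (g ^+ n) i = sec g i ^+ n.
Proof. by move=> g1; elim: n => // n IH; rewrite !expgS secM g1 perm1 IH. Qed.

Lemma rt_x : rt x = cyc. Proof. by []. Qed.
Lemma sec_x i : sec x i = 1.
Proof. by apply/funext => v; rewrite /sec /=; do 2?[case: ifP]. Qed.
Lemma rt_Delta g : rt (Delta g) = 1. Proof. by []. Qed.
Lemma sec_Delta g i : sec (Delta g) i = g.
Proof. by apply/funext => v; rewrite /sec /=; do 2?[case: ifP]. Qed.
Lemma rt_gamma : rt gam = 1. Proof. by []. Qed.
Lemma sec_gamma0 : sec gam 0%R = gam. Proof. by []. Qed.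
Lemma sec_gamma1 : sec gam 1%R = x. Proof. by []. Qed.
Lemma sec_gamma2 : sec gam 2%:R%R = x^-1. Proof. by []. Qed.
Definition sec_gamma := (sec_gamma0, sec_gamma1, sec_gamma2).
Lemma rt_Partial g : rt (Partial g) = 1. Proof. by []. Qed.
Lemma sec_Partial0 g : sec (Partial g) 0%R = 1. Proof. by []. Qed.
Lemma sec_Partial1 g : sec (Partial g) 1%R = g. Proof. by []. Qed.
Lemma sec_Partial2 g : sec (Partial g) 2%:R%R = g^-1. Proof. by []. Qed.
Definition sec_Partial := (sec_Partial0, sec_Partial1, sec_Partial2).
Lemma rt_tau1 : rt (ta 1) = tr12. Proof. by []. Qed.
Lemma rt_tau2 : rt (ta 2) = 1. Proof. by []. Qed.
Lemma rt_tau3 : rt (ta 3) = tr12. Proof. by []. Qed.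
Lemma sec_tau1 i : sec (ta 1) i = ta 1. Proof. by []. Qed.
Lemma sec_tau2 i : sec (ta 2) i = ta 3. Proof. by []. Qed.
Lemma sec_tau3 i : sec (ta 3) i = ta 2. Proof. by []. Qed.
Definition rt_tau := (rt_tau1, rt_tau2, rt_tau3).
Definition sec_tau := (sec_tau1, sec_tau2, sec_tau3).

Lemma Delta1 : Delta 1 = 1.
Proof. by apply: Wext => // i; rewrite sec_Delta. Qed.
Lemma DeltaM g h : Delta (g * h) = Delta g * Delta h.
Proof. by apply: Wext => [|i]; rewrite ?rtM ?secM ?rt_Delta ?mulg1 // !sec_Delta. Qed.
Lemma DeltaV g : Delta g^-1 = (Delta g)^-1.
Proof. by apply: Wext => [|i]; rewrite ?rtV ?secV ?rt_Delta ?invg1 // !sec_Delta. Qed.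
Lemma DeltaX g n : Delta (g ^+ n) = Delta g ^+ n.
Proof. by elim: n => [|n IH]; rewrite ?Delta1 // !expgS DeltaM IH. Qed.
Lemma x3 : x ^+ 3 = 1.
Proof.
apply: Wext => [|i]; last by rewrite !expgS expg0 !secM !sec_x !mul1g.
by rewrite rtX; apply/permP => i; rewrite rt_x cycX perm1; move: i; z3.
Qed.

Lemma gamma3 : gam ^+ 3 = 1.
Proof.
apply: (@bisim (fun g h => g = gam ^+ 3 /\ h = 1)) => // g h [-> ->]; split.
  by rewrite rtX rt_gamma expg1n.
by apply: I3P; rewrite secX // sec_gamma; [left | right | right]; rewrite ?expVgn ?x3 ?invg1.
Qed.

Lemma commute_x_Delta g : commute x (Delta g).
Proof.
apply: Wext => [|i]; first by rewrite !rtM rt_Delta mulg1 mul1g.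
by rewrite !secM !sec_x !sec_Delta mul1g mulg1.
Qed.

(** * The Klein four-group V and its action on the generators *)

Lemma tau_sq1 : ta 1 * ta 1 = 1.
Proof.
apply: (@bisim (fun g h => g = ta 1 * ta 1 /\ h = 1)) => // g h [-> ->].
by rewrite rtM rt_tau /tr12 tperm2; split=> // i; left.
Qed.

(** Both identities are proved at once, because [tau 2] and [tau 3] are the sections of each
    other. *)
Lemma tau_sq23 : ta 2 * ta 2 = 1 /\ ta 3 * ta 3 = 1.
Proof.
suff H : forall g h : W, (g = ta 2 * ta 2 \/ g = ta 3 * ta 3) /\ h = 1 -> g = h.
  by split; apply: H; split; auto.
apply: bisim => g h [[->|->] ->]; rewrite rtM !rt_tau ?mulg1 /tr12 ?tperm2; split=> // i; left;
 by rewrite secM sec_tau; auto.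
Qed.
Lemma tau_sq2 : ta 2 * ta 2 = 1. Proof. by case: tau_sq23. Qed.
Lemma tau_sq3 : ta 3 * ta 3 = 1. Proof. by case: tau_sq23. Qed.

Lemma tau12_13 : ta 1 * ta 2 = ta 3 /\ ta 1 * ta 3 = ta 2.
Proof.
suff H : forall g h : W, (g = ta 1 * ta 2 /\ h = ta 3) \/ (g = ta 1 * ta 3 /\ h = ta 2) -> g = h.
  by split; apply: H; auto.
apply: bisim => g h [[-> ->]|[-> ->]]; rewrite rtM !rt_tau ?mulg1 /tr12 ?tperm2; split=> // i; left;
 by rewrite secM !sec_tau; auto.
Qed.
Lemma tau12 : ta 1 * ta 2 = ta 3. Proof. by case: tau12_13. Qed.
Lemma tau13 : ta 1 * ta 3 = ta 2. Proof. by case: tau12_13. Qed.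
Lemma tauV i : i \in [:: 1; 2; 3]%N -> (ta i)^-1 = ta i.
Proof.
by rewrite !inE => /or3P[] /eqP ->; apply: mulg1_eq; rewrite (tau_sq1, tau_sq2, tau_sq3).
Qed.
Lemma tau1V : (ta 1)^-1 = ta 1. Proof. exact: tauV. Qed.
Lemma tau2V : (ta 2)^-1 = ta 2. Proof. exact: tauV. Qed.
Lemma tau3V : (ta 3)^-1 = ta 3. Proof. exact: tauV. Qed.
Lemma tau21 : ta 2 * ta 1 = ta 3. Proof. by rewrite -[LHS]invgK invgM tau1V tau2V tau12 tau3V. Qed.
Lemma tau31 : ta 3 * ta 1 = ta 2. Proof. by rewrite -[LHS]invgK invgM tau1V tau3V tau13 tau2V. Qed.
Lemma tau23 : ta 2 * ta 3 = ta 1. Proof. by rewrite -[in LHS]tau21 mulgA tau_sq2 mul1g. Qed.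
Lemma tau32 : ta 3 * ta 2 = ta 1. Proof. by rewrite -[in LHS]tau31 mulgA tau_sq3 mul1g. Qed.
Definition tauE := (tau_sq1, tau_sq2, tau_sq3, tau12, tau13, tau21, tau31, tau23, tau32, tau1V, tau2V, tau3V).

Lemma Delta_tau1 g : Delta g ^ ta 1 = Delta (g ^ ta 1).
Proof.
apply: Wext => [|i]; first by rewrite rtJ !rt_Delta conj1g.
by rewrite /conjg !secM secV !sec_tau !sec_Delta.
Qed.
Lemma Delta_tau2 g : Delta g ^ ta 2 = Delta (g ^ ta 3).
Proof.
apply: Wext => [|i]; first by rewrite rtJ !rt_Delta conj1g.
by rewrite /conjg !secM secV !sec_tau !sec_Delta.
Qed.
Lemma Delta_tau3 g : Delta g ^ ta 3 = Delta (g ^ ta 2).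
Proof.
apply: Wext => [|i]; first by rewrite rtJ !rt_Delta conj1g.
by rewrite /conjg !secM secV !sec_tau !sec_Delta.
Qed.

Lemma tau2E : ta 2 = Delta (ta 3).
Proof. by apply: Wext => // i; rewrite sec_Delta sec_tau. Qed.

Lemma x_tau2 : x ^ ta 2 = x.
Proof. by apply/conjg_fixP/eqP; rewrite tau2E; apply/eqP/commgP; exact: commute_x_Delta. Qed.

Lemma cyc_tr12 : cyc ^ tr12 = cyc^-1.
Proof.
apply/permP => i; apply: (@perm_inj _ cyc); rewrite permKV cycE.
by rewrite /conjg 2!permM /tr12 tpermV -/tr12 !tr12E cycE; move: i; z3.
Qed.

Lemma x_tau1 : x ^ ta 1 = x^-1.
Proof.
apply: Wext => [|i]; first by rewrite rtJ rtV rt_x rt_tau cyc_tr12.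
by rewrite /conjg !secM !secV !sec_x !sec_tau mul1g mulVg invg1.
Qed.

Lemma x_tau3 : x ^ ta 3 = x^-1.
Proof. by rewrite -tau12 conjgM x_tau1 conjVg x_tau2. Qed.

Lemma secJ_tau1 g i : sec (g ^ ta 1) i = sec g (- i)%R ^ ta 1.
Proof. by rewrite /conjg !secM secV rtV !sec_tau rt_tau /tr12 tpermV -/tr12 tr12E. Qed.
Lemma secJ_tau3 g i : sec (g ^ ta 3) i = sec g (- i)%R ^ ta 2.
Proof. by rewrite /conjg !secM secV rtV !sec_tau rt_tau /tr12 tpermV -/tr12 tr12E. Qed.
Lemma secJ_tau2 g i : sec (g ^ ta 2) i = sec g i ^ ta 3.
Proof. by rewrite /conjg !secM secV rtV !sec_tau rt_tau invg1 !perm1. Qed.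

Lemma opp0 : (- 0)%R = 0%R :> 'Z_3. Proof. z3. Qed.
Lemma opp1 : (- 1)%R = 2%:R%R :> 'Z_3. Proof. z3. Qed.
Lemma opp2 : (- 2%:R)%R = 1%R :> 'Z_3. Proof. z3. Qed.
Definition oppE := (opp0, opp1, opp2).

Lemma gamma_tau1 : gam ^ ta 1 = gam.
Proof.
apply: (@bisim (fun g h => g = gam ^ ta 1 /\ h = gam)) => // g h [-> ->].
rewrite rtJ rt_gamma conj1g; split=> //.
apply: I3P; rewrite secJ_tau1 // oppE !sec_gamma; first by left.
  by right; rewrite conjVg x_tau1 invgK.
by right; rewrite x_tau1.
Qed.

Lemma gamma_tau23 : gam ^ ta 2 = gam^-1 /\ gam ^ ta 3 = gam^-1.
Proof.
suff H : forall g h : W, (g = gam ^ ta 2 \/ g = gam ^ ta 3) /\ h = gam^-1 -> g = h.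
  by split; apply: H; auto.
apply: bisim => g h [[->|->] ->]; rewrite rtJ rtV rt_gamma conj1g invg1; split=> //;
  apply: I3P; rewrite secV rt_gamma invg1 perm1 ?secJ_tau2 ?secJ_tau3 // ?oppE !sec_gamma;
  try (by left; auto); by right; rewrite ?conjVg ?x_tau3 ?x_tau2 ?invgK.
Qed.
Lemma gamma_tau2 : gam ^ ta 2 = gam^-1. Proof. by case: gamma_tau23. Qed.
Lemma gamma_tau3 : gam ^ ta 3 = gam^-1. Proof. by case: gamma_tau23. Qed.

(** * Exponents *)

Section Subgroups.
Variable H : wset.
Hypothesis sH : is_subgroup H.

Lemma sub1 : H 1. Proof. by case: sH. Qed.
Lemma subM g h : H g -> H h -> H (g * h). Proof. by case: sH => _ [sM _]; apply: sM. Qed.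
Lemma subV g : H g -> H g^-1. Proof. by case: sH => _ [_ sV]; apply: sV. Qed.
Lemma subX g n : H g -> H (g ^+ n).
Proof. by move=> Hg; elim: n => [|n IH]; [exact: sub1 | rewrite expgS; exact: subM]. Qed.
Lemma subJ g h : H g -> H h -> H (g ^ h).
Proof. by move=> Hg Hh; apply: subM; [exact: subV | exact: subM]. Qed.

Lemma subMr g h : H h -> H (g * h) -> H g.
Proof. by move=> Hh /subM /(_ (subV Hh)); rewrite mulgK. Qed.
Lemma subMl g h : H g -> H (g * h) -> H h.
Proof. by move=> Hg /(subM (subV Hg)); rewrite mulKg. Qed.

Variable f : W -> 'Z_3.
Definition additive_on := forall g h, H g -> H h -> f (g * h) = (f g + f h)%R.
Hypothesis fD : additive_on.
Lemma addf1 : f 1 = 0%R.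
Proof. by move: (fD sub1 sub1); rewrite mulg1; move: (f 1); z3. Qed.
Lemma addfV g : H g -> f g^-1 = (- f g)%R.
Proof. by move=> Hg; move: (fD (subV Hg) Hg); rewrite mulVg addf1; move: (f g) (f g^-1); z3. Qed.
Lemma addfX g n : H g -> f (g ^+ n) = (n%:R * f g)%R.
Proof.
move=> Hg; elim: n => [|n IH]; first by rewrite addf1 mul0r.
by rewrite expgS fD ?IH; [rewrite -natr1; ring | | exact: subX].
Qed.
Lemma addfJ g h : H g -> H h -> f (g ^ h) = f g.
Proof.
move=> Hg Hh; rewrite !fD ?addfV //; [by ring | exact: subV | exact: subM].
Qed.
End Subgroups.

Lemma sub_gen S : is_subgroup (gen S).
Proof.
split; [|split].
- by move=> H sH _; exact: sub1.
- by move=> g h Sg Sh H sH SH; apply: subM => //; [exact: Sg | exact: Sh].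
- by move=> g Sg H sH SH; apply: subV => //; exact: Sg.
Qed.
Lemma mem_gen (S : wset) g : S g -> gen S g. Proof. by move=> Sg H sH; apply. Qed.

(** Membership in [gen S] is supplied in the product and inverse cases, since most functions below
    are additive only on the group concerned. *)
Lemma gen_ind (S P : wset) :
  P 1 -> (forall s, S s -> P s) ->
  (forall g h, gen S g -> gen S h -> P g -> P h -> P (g * h)) ->
  (forall g, gen S g -> P g -> P g^-1) -> forall g, gen S g -> P g.
Proof.
move=> P1 PS PM PV g Sg; suff [] : gen S g /\ P g by [].
apply: (Sg (fun g => gen S g /\ P g)).
  split; [|split]; first by split=> //; exact: (sub1 (sub_gen S)).
    by move=> h k [Sh Ph] [Sk Pk]; split; [exact: (subM (sub_gen S)) | exact: PM].
  by move=> h [Sh Ph]; split; [exact: (subV (sub_gen S)) | exact: PV].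
by move=> s Ss; split; [exact: mem_gen | exact: PS].
Qed.

(* On [E], which contains all the groups below, [b] and [a] are additive: they are the exponent sums
   of [x] and [gamma], read off the action on the first two levels. *)
Definition b (g : W) : 'Z_3 := rt g 0%R.
Definition a (g : W) : 'Z_3 := (b (sec g 1%R) - b (sec g 0%R))%R.
Definition E : wset := fun g =>
  [/\ even (rt g), forall i, even (rt (sec g i))
    & forall i : 'Z_3, b (sec g i) = (b (sec g 0%R) + i * a g)%R].

Lemma bM g h : even (rt h) -> b (g * h) = (b g + b h)%R.
Proof. by move=> eh; rewrite /b rtM permM eh. Qed.

Lemma b1 : b 1 = 0%R. Proof. by rewrite /b rt1 perm1. Qed.

Lemma bV g : even (rt g) -> b g^-1 = (- b g)%R.
Proof.
move=> eg; have := bM g^-1 eg; rewrite mulVg b1.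
by move: (b g^-1) (b g); z3.
Qed.

Lemma rtE g (i : 'Z_3) : even (rt g) -> rt g i = (i + b g)%R.
Proof. by move=> ->. Qed.
Lemma rtVE g (i : 'Z_3) : even (rt g) -> (rt g)^-1 i = (i - b g)%R.
Proof. by move=> eg; rewrite -rtV rtE ?bV //; exact: evenV. Qed.

Lemma b_secM g h (i : 'Z_3) : E g -> E h ->
  b (sec (g * h) i) = (b (sec g i) + b (sec h (i + b g)))%R.
Proof. by case=> eg _ _ [_ esh _]; rewrite secM bM // rtE. Qed.

Lemma b_secV g (i : 'Z_3) : E g -> b (sec g^-1 i) = (- b (sec g (i - b g)))%R.
Proof. by case=> eg esg _; rewrite secV bV // rtVE. Qed.

Lemma E_progression g : E g -> exists c, forall i : 'Z_3, b (sec g i) = (c + i * a g)%R.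
Proof. by case=> _ _ Ag; exists (b (sec g 0%R)). Qed.

Lemma progression_E g c d : even (rt g) -> (forall i, even (rt (sec g i))) ->
  (forall i : 'Z_3, b (sec g i) = (c + i * d)%R) -> E g.
Proof. by move=> eg esg Ag; split=> // i; rewrite /a !Ag; ring. Qed.

(** The exponents [b] of the sections form an arithmetic progression with step [a]. The root of [g]
    only shifts the progression of [h], so the steps add. *)
Lemma a_E : additive_on E a.
Proof.
move=> g h Eg Eh; have [cg Ag] := E_progression Eg; have [ch Ah] := E_progression Eh.
by rewrite {1}/a !b_secM // !Ag !Ah; ring.
Qed.

Lemma sub_E : is_subgroup E.
Proof.
split; [|split].
- apply: (@progression_E _ 0%R 0%R); [exact: even1 | by move=> i; exact: even1 |].
  by move=> i; rewrite sec1 b1 mulr0 addr0.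
- move=> g h Eg Eh; have [cg Ag] := E_progression Eg; have [ch Ah] := E_progression Eh.
  case: (Eg) (Eh) => [eg esg _] [eh esh _]; rewrite wmulE.
  apply: (@progression_E _ (cg + ch + b g * a h)%R (a g + a h)%R) => [|i|i].
  + exact: evenM.
  + by rewrite secM rtM; apply: evenM.
  + by rewrite b_secM // Ag Ah; ring.
- move=> g Eg; have [cg Ag] := E_progression Eg; case: (Eg) => [eg esg _]; rewrite winvE.
  apply: (@progression_E _ (- cg + b g * a g)%R (- a g)%R) => [|i|i].
  + exact: evenV.
  + by rewrite secV rtV; apply: evenV.
  + by rewrite b_secV // Ag; ring.
Qed.

Lemma b_E : additive_on E b.
Proof. by move=> g h _ [eh _ _]; exact: bM. Qed.

(* An element with sections in [Gamma] and root in the group of [x] lies in [Gamma] if and only if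
   [kappa] vanishes: the [x]-exponent of each section is prescribed by the [gamma]-exponents of the
   two others (see [kappa_Gamma] and [Gamma_crit]). *)
Definition kappa (g : W) (i : 'Z_3) : 'Z_3 :=
  (b (sec g i) - a (sec g (i + 2%:R)%R) + a (sec g (i + 1)%R))%R.

Lemma kappaM g h i : E g -> E h -> (forall j, E (sec g j)) -> (forall j, E (sec h j)) ->
  kappa (g * h) i = (kappa g i + kappa h (i + b g))%R.
Proof.
move=> Eg Eh Esg Esh; have [eg _ _] := Eg.
rewrite /kappa b_secM // !secM !a_E // !rtE // ![(i + b g + _)%R]addrAC.
by ring.
Qed.

(* [beta n g] is the exponent of [Delta^n x] in [g]; it is meaningful (additive) only on [B]. *)
Fixpoint beta (n : nat) (g : W) : 'Z_3 :=
  if n is m.+1 then (if m is 0 then kappa g 0%R else beta m (sec g 0%R)) else b g.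

Lemma betaSS n g : beta n.+2 g = beta n.+1 (sec g 0%R). Proof. by []. Qed.

Definition xn n : W := DeltaN n x.
Lemma xnS n : xn n.+1 = Delta (xn n). Proof. by []. Qed.
(* [B] is [Gamma U]: see [B_decomp]. *)
Definition B : wset := gen (fun g => g = gam \/ exists n, g = xn n).
Lemma sub_B : is_subgroup B. Proof. exact: sub_gen. Qed.
Lemma B_gamma : B gam. Proof. by apply: mem_gen; left. Qed.
Lemma B_xn n : B (xn n). Proof. by apply: mem_gen; right; exists n. Qed.
Lemma B_x : B x. Proof. exact: (B_xn 0). Qed.

Lemma b_x : b x = 1%R. Proof. by rewrite /b rt_x cycE add0r. Qed.
Lemma b_gamma : b gam = 0%R. Proof. by rewrite /b rt_gamma perm1. Qed.
Lemma b_Delta g : b (Delta g) = 0%R. Proof. by rewrite /b rt_Delta perm1. Qed.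
Lemma even_x : even (rt x). Proof. by rewrite rt_x; exact: even_cyc. Qed.
Lemma b_xV : b x^-1 = (-1)%R. Proof. by rewrite bV ?b_x //; exact: even_x. Qed.
Lemma a_x : a x = 0%R. Proof. by rewrite /a !sec_x subrr. Qed.
Lemma a_Delta g : a (Delta g) = 0%R. Proof. by rewrite /a !sec_Delta subrr. Qed.
Lemma a_gamma : a gam = 1%R. Proof. by rewrite /a !sec_gamma b_gamma b_x subr0. Qed.

Lemma E_x : E x.
Proof. by split=> [|i|i]; rewrite ?sec_x ?a_x; [exact: even_x|exact: even1| rewrite mulr0 addr0]. Qed.
Lemma E_Delta g : even (rt g) -> E (Delta g).
Proof. by move=> eg; split=> [|i|i]; rewrite ?sec_Delta ?a_Delta ?mulr0 ?addr0 //; exact: even1. Qed.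
Lemma even_xn n : even (rt (xn n)).
Proof. by case: n => [|n]; [exact: even_x | exact: even1]. Qed.
Lemma E_xn n : E (xn n).
Proof. by case: n => [|n]; [exact: E_x | apply: E_Delta; exact: even_xn]. Qed.
Lemma E_gamma : E gam.
Proof.
split; first exact: even1.
  apply: I3P; rewrite sec_gamma; [exact: even1 | exact: even_x |].
  by rewrite rtV; apply: evenV; exact: even_x.
by apply: I3P; rewrite a_gamma !sec_gamma b_gamma ?b_x ?b_xV; z3.
Qed.

Lemma B_E g : B g -> E g.
Proof. by apply; [exact: sub_E | move=> s [->|[n ->]]; [exact: E_gamma | exact: E_xn]]. Qed.

Lemma B_sec g i : B g -> B (sec g i).
Proof.
move=> Bg; move: g Bg i; apply: gen_ind => [i|s [->|[[|n] ->]]|g h _ _ Bg Bh i|g _ Bg i].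
- exact: (sub1 sub_B).
- apply: I3P; rewrite sec_gamma; [exact: B_gamma | exact: B_x |].
  by apply: (subV sub_B); exact: B_x.
- by move=> i; rewrite sec_x; exact: (sub1 sub_B).
- by move=> i; rewrite xnS sec_Delta; exact: B_xn.
- by rewrite secM; exact: (subM sub_B).
- by rewrite secV; exact: (subV sub_B).
Qed.

Lemma even_B g : B g -> even (rt g). Proof. by move/B_E => []. Qed.
Lemma a_B : additive_on B a. Proof. by move=> g h /B_E Eg /B_E; exact: a_E. Qed.
Lemma b_B : additive_on B b. Proof. by move=> g h /B_E Eg /B_E; exact: b_E. Qed.
Lemma a_xV : a x^-1 = 0%R. Proof. by rewrite (addfV sub_B a_B B_x) a_x oppr0. Qed.

Lemma kappa_B g h i : B g -> B h -> kappa (g * h) i = (kappa g i + kappa h (i + b g))%R.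
Proof. by move=> Bg Bh; apply: kappaM => [||j|j]; apply: B_E => //; exact: B_sec. Qed.

Lemma kappa_x i : kappa x i = 0%R.
Proof. by rewrite /kappa !sec_x b1 /a !sec1 b1 !subrr addr0. Qed.
Lemma kappa_Delta g i : kappa (Delta g) i = b g.
Proof. by rewrite /kappa !sec_Delta subrK. Qed.
Lemma kappa_gamma i : kappa gam i = 0%R.
Proof.
have e1 : (1 + 2%:R)%R = 0%R :> 'Z_3 by z3.
have e2 : (2%:R + 2%:R)%R = 1%R :> 'Z_3 by z3.
have e3 : (2%:R + 1)%R = 0%R :> 'Z_3 by z3.
have e4 : (1 + 1)%R = 2%:R%R :> 'Z_3 by z3.
by move: i; apply: I3P; rewrite /kappa ?add0r ?(e1, e2, e3, e4) !sec_gamma ?b_gamma ?b_x ?b_xV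
  ?a_gamma ?a_x ?a_xV; z3.
Qed.

(** On generators [kappa] does not depend on the index, and the product rule only shifts the index
    of the second summand. *)
Lemma kappa_const g i : B g -> kappa g i = kappa g 0%R.
Proof.
move=> Bg; move: g Bg i; apply: gen_ind => [i|s [->|[[|n] ->]] i|g h Bg Bh kg kh i|g Bg kg i].
- by rewrite /kappa !sec1 b1 /a !sec1 b1.
- by rewrite !kappa_gamma.
- by rewrite !kappa_x.
- by rewrite xnS !kappa_Delta.
- by rewrite !kappa_B // kg [in LHS]kh [in RHS]kh.
- have k1 j : (kappa g j + kappa (g^-1)%g (j + b g))%R = 0%R.
    by rewrite -kappa_B // ?mulgV; [rewrite /kappa !sec1 b1 /a !sec1 b1 !subrr addr0 | exact: (subV sub_B)].
  move: (k1 (i - b g)%R) (k1 (0 - b g)%R); rewrite !subrK kg [kappa g (0 - _)%R]kg.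
  by move: (kappa g 0%R) (kappa g^-1 i) (kappa g^-1 0%R); z3.
Qed.

(** The two claims alternate: additivity at one level, with vanishing on [x] and [gamma], gives
    independence of the section, and this absorbs the root permutation in the additivity at the next
    level. Level 0 is excluded because [b x] is 1. *)
Lemma beta_spec n : additive_on B (beta n) /\
  (forall g i, 0 < n -> B g -> beta n (sec g i) = beta n (sec g 0%R)).
Proof.
suff H k : additive_on B (beta k) -> (0 < k -> beta k x = 0%R /\ beta k gam = 0%R) ->
    forall g i, 0 < k -> B g -> beta k (sec g i) = beta k (sec g 0%R).
  have H2 k : additive_on B (beta k) /\ (0 < k -> beta k x = 0%R /\ beta k gam = 0%R).
    elim: k => [|[|k] [IHa IH0]]; first by split=> //; exact: b_B.
      split; first by move=> g h Bg Bh; rewrite /= kappa_B // [kappa h _]kappa_const.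
      by move=> _; rewrite /= kappa_x kappa_gamma.
    split; last by move=> _; rewrite !betaSS sec_x sec_gamma0 (addf1 sub_B IHa); case: IH0.
    move=> g h Bg Bh; rewrite !betaSS secM IHa; try exact: B_sec.
    by congr (_ + _)%R; apply: (H _ IHa).
  by have [fD f0] := H2 n; split=> // g i; exact: H.
move=> fD f0 g i k0 Bg; have {f0} [fx fg] := f0 k0.
move: g Bg i; apply: gen_ind => [i|s [->|[[|m] ->]]|g h Bg Bh kg kh i|g Bg kg i].
- by rewrite !sec1.
- by apply: I3P; rewrite !sec_gamma ?(addfV sub_B fD B_x) ?fx ?fg ?oppr0.
- by move=> i; rewrite !sec_x.
- by move=> i; rewrite xnS !sec_Delta.
- by rewrite !secM !fD; try exact: B_sec; rewrite kg [in LHS]kh [in RHS]kh.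
- by rewrite !secV !(addfV sub_B fD); try exact: B_sec; rewrite kg [in RHS]kg.
Qed.

Lemma beta_B n : additive_on B (beta n). Proof. by case: (beta_spec n). Qed.
Lemma beta_sec n g i : B g -> beta n.+1 (sec g i) = beta n.+2 g.
Proof. by move=> Bg; rewrite betaSS; case: (beta_spec n.+1) => _; apply. Qed.
Lemma beta_Delta n g : beta n.+1 (Delta g) = beta n g.
Proof. by case: n => [|n]; [exact: kappa_Delta | rewrite betaSS sec_Delta]. Qed.
Lemma beta0_Delta g : beta 0 (Delta g) = 0%R. Proof. exact: b_Delta. Qed.
Lemma beta1 n : beta n 1 = 0%R. Proof. exact: (addf1 sub_B (@beta_B n)). Qed.
Lemma betaS_x n : beta n.+1 x = 0%R.
Proof. by case: n => [|n]; [exact: kappa_x | rewrite betaSS sec_x beta1]. Qed.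
Lemma betaS_gamma n : beta n.+1 gam = 0%R.
Proof. by elim: n => [|n IH]; [exact: kappa_gamma | rewrite betaSS sec_gamma0]. Qed.

(** * Gamma, and the abelian group of all Delta^n x *)

Lemma sub_Gamma : is_subgroup Gamma. Proof. exact: sub_gen. Qed.
Lemma Gamma_x : Gamma x. Proof. by apply: mem_gen; left. Qed.
Lemma Gamma_gamma : Gamma gam. Proof. by apply: mem_gen; right. Qed.
Lemma Gamma_B g : Gamma g -> B g.
Proof. by apply; [exact: sub_B | move=> s [->|->]; [exact: B_x | exact: B_gamma]]. Qed.
Lemma Gamma_sec g i : Gamma g -> Gamma (sec g i).
Proof.
move=> Gg; move: g Gg i; apply: gen_ind => [i|s [->|->]|g h _ _ Bg Bh i|g _ Bg i].
- exact: (sub1 sub_Gamma).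
- by move=> i; rewrite sec_x; exact: (sub1 sub_Gamma).
- apply: I3P; rewrite sec_gamma; [exact: Gamma_gamma | exact: Gamma_x |].
  by apply: (subV sub_Gamma); exact: Gamma_x.
- by rewrite secM; exact: (subM sub_Gamma).
- by rewrite secV; exact: (subV sub_Gamma).
Qed.

Lemma additive_Gamma f g : (forall h k, Gamma h -> Gamma k -> f (h * k) = (f h + f k)%R) -> Gamma g ->
  f g = (a g * f gam + b g * f x)%R.
Proof.
move=> fD; move: g; apply: gen_ind => [|s [->|->]|g h Gg Gh eg eh|g Gg eg].
- by rewrite (addf1 sub_Gamma fD) b1 (addf1 sub_B a_B); ring.
- by rewrite a_x b_x; ring.
- by rewrite a_gamma b_gamma; ring.
- by rewrite fD // a_B ?b_B ?eg ?eh; [ring | exact: Gamma_B..].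
- by rewrite (addfV sub_Gamma fD) // (addfV sub_B a_B) ?(addfV sub_B b_B) ?eg; [ring | exact: Gamma_B..].
Qed.

Lemma beta_Gamma n g : Gamma g -> beta n.+1 g = 0%R.
Proof.
move=> Gg; rewrite (@additive_Gamma (beta n.+1) g) // ?betaS_x ?betaS_gamma ?mulr0 ?addr0 //.
by move=> h k /Gamma_B Bh /Gamma_B; exact: beta_B.
Qed.
Lemma kappa_Gamma g i : Gamma g -> kappa g i = 0%R.
Proof. by move=> Gg; rewrite kappa_const; [exact: (@beta_Gamma 0) | exact: Gamma_B]. Qed.

(** The abelian group generated by all Delta^n x with n >= 0, in nested form: peeling off one
    constructor shifts the exponents [beta] by one level. *)
Inductive Uh : W -> Prop :=
| Uh1 : Uh 1
| UhS n w : Uh w -> Uh (x ^+ n * Delta w).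

Lemma commute_xX_Delta n g : commute (x ^+ n) (Delta g).
Proof. by apply: commute_sym; apply: commuteX; apply: commute_sym; exact: commute_x_Delta. Qed.

Lemma Uh_x n : Uh (x ^+ n).
Proof. by rewrite -[x ^+ n]mulg1 -Delta1; apply: UhS; exact: Uh1. Qed.
Lemma Uh_Delta w : Uh w -> Uh (Delta w).
Proof. by rewrite -[Delta w]mul1g -(expg0 x); exact: UhS. Qed.
Lemma Uh_xn n : Uh (xn n).
Proof. by elim: n => [|n IH]; [exact: (Uh_x 1) | rewrite xnS; exact: Uh_Delta]. Qed.

Lemma UhM w v : Uh w -> Uh v -> Uh (w * v).
Proof.
move=> Uw; elim: Uw v => [v|n {}w Uw IH v [|m {}v Uv]]; first by rewrite mul1g.
  by rewrite mulg1; exact: UhS.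
rewrite -mulgA [Delta w * _]mulgA -[Delta w * x ^+ m]commute_xX_Delta -mulgA -DeltaM mulgA -expgnDr.
by apply: UhS; exact: IH.
Qed.
Lemma UhX w n : Uh w -> Uh (w ^+ n).
Proof. by move=> Uw; elim: n => [|n IH]; [exact: Uh1 | rewrite expgS; exact: UhM]. Qed.
Lemma Uh_exp3 w : Uh w -> w ^+ 3 = 1.
Proof.
elim=> [|n {}w _ IH]; first exact: expg1n.
rewrite expgMn; last exact: commute_xX_Delta.
by rewrite -DeltaX IH -expgnA mulnC expgnA x3 expg1n Delta1 mulg1.
Qed.
Lemma exp3V (g : W) : g ^+ 3 = 1 -> g^-1 = g ^+ 2.
Proof. by move=> g3; apply: mulg1_eq; rewrite -expgS. Qed.
Lemma UhV w : Uh w -> Uh w^-1.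
Proof. by move=> Uw; rewrite (exp3V (Uh_exp3 Uw)); exact: UhX. Qed.
Lemma Uh_commute w v : Uh w -> Uh v -> commute w v.
Proof.
move=> Uw; elim: Uw v => [v _|n {}w Uw IH v [|m {}v Uv]]; try by apply: commute_sym; exact: commute1.
  exact: commute1.
have cD : commute (Delta w) (Delta v) by rewrite /commute -!DeltaM IH.
apply: commuteM; apply: commute_sym; apply: commuteM.
- by apply: commuteX2.
- exact: commute_xX_Delta.
- by apply: commute_sym; exact: commute_xX_Delta.
- exact: commute_sym.
Qed.
Lemma UhJ w v : Uh w -> Uh v -> w ^ v = w.
Proof. by move=> Uw Uv; apply/conjg_fixP/eqP; apply/eqP/commgP; exact: Uh_commute. Qed.
Lemma Uh_gen w : Uh w -> gen (fun g => exists n, g = xn n) w.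
Proof.
have sG := sub_gen (fun g => exists n, g = xn n).
elim=> [|n {}w _ IH]; first exact: (sub1 sG).
apply: (subM sG); first by apply: (subX sG); apply: mem_gen; exists 0.
move: w IH; apply: gen_ind => [|s [m ->]|g h _ _ Gg Gh|g _ Gg].
- by rewrite Delta1; exact: (sub1 sG).
- by apply: mem_gen; exists m.+1.
- by rewrite DeltaM; exact: (subM sG).
- by rewrite DeltaV; exact: (subV sG).
Qed.
Lemma Uh_B w : Uh w -> B w.
Proof. by move/Uh_gen; apply; [exact: sub_B | move=> s [n ->]; exact: B_xn]. Qed.

Lemma U_Delta g : U g <-> exists2 w, Uh w & g = Delta w.
Proof.
split.
  move=> Ug; apply: (Ug (fun g => exists2 w, Uh w & g = Delta w)).
  2: by move=> s [[|n] [//= _ ->]]; exists (xn n) => //; exact: Uh_xn.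
  split; [|split].
  - by exists 1; [exact: Uh1 | rewrite Delta1].
  - by move=> _ _ [w Uw ->] [v Uv ->]; exists (w * v); [exact: UhM | rewrite DeltaM].
  - by move=> _ [w Uw ->]; exists w^-1; [exact: UhV | rewrite DeltaV].
case=> w /Uh_gen Uw ->; have sU : is_subgroup U by exact: sub_gen.
move: w Uw; apply: gen_ind => [|s [n ->]|g' h _ _ Gg Gh|g' _ Gg].
- by rewrite Delta1; exact: (sub1 sU).
- by apply: mem_gen; exists n.+1.
- by rewrite DeltaM; exact: (subM sU).
- by rewrite DeltaV; exact: (subV sU).
Qed.

Lemma Uh_a w : Uh w -> a w = 0%R.
Proof.
case=> [|n v Uv]; first by rewrite /a !sec1 subrr.
have Bx : B (x ^+ n) by apply: (subX sub_B); exact: B_x.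
have BD : B (Delta v) by apply: Uh_B; exact: Uh_Delta.
by rewrite a_B // (addfX sub_B a_B n B_x) a_x a_Delta mulr0 addr0.
Qed.

Lemma exp3_mod (g : W) n : g ^+ 3 = 1 -> g ^+ n = g ^+ (n%:R : 'Z_3)%R.
Proof.
move=> g3; rewrite [RHS](_ : _ = g ^+ (n %% 3)); last by congr (g ^+ _); rewrite val_Zp_nat.
by rewrite {1}(divn_eq n 3) expgnDr mulnC expgnA g3 expg1n mul1g.
Qed.

Lemma beta_UhS m n w : Uh w -> beta m (x ^+ n * Delta w) = if m is k.+1 then beta k w else n%:R%R.
Proof.
move=> Uw; have Bx : B (x ^+ n) by apply: (subX sub_B); exact: B_x.
have BD : B (Delta w) by apply: Uh_B; exact: Uh_Delta.
rewrite beta_B // (addfX sub_B (@beta_B m) n B_x).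
by case: m => [|m]; rewrite ?betaS_x ?beta_Delta ?mulr0 ?add0r // beta0_Delta /= b_x mulr1 addr0.
Qed.

Lemma Uh_eq1 w : Uh w -> (forall n, beta n w = 0%R) -> w = 1.
Proof.
elim=> // n {}w Uw IH H.
have -> : w = 1 by apply: IH => k; rewrite -(H k.+1) beta_UhS.
have := H 0; rewrite beta_UhS // => n0.
by rewrite Delta1 mulg1 (exp3_mod n x3) n0.
Qed.

(** * A membership criterion for the Gupta-Sidki group *)

Lemma rt_xX n (i : 'Z_3) : rt (x ^+ n) i = (i + n%:R)%R.
Proof. by rewrite rtX rt_x cycX. Qed.
Lemma sec_xX n i : sec (x ^+ n) i = 1.
Proof. by elim: n i => [|n IH] i //; rewrite expgS secM sec_x IH mulg1. Qed.
Lemma secMxX g n i : sec (g * x ^+ n) i = sec g i.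
Proof. by rewrite secM sec_xX mulg1. Qed.

Lemma secJxX g n (i : 'Z_3) : sec (g ^ (x ^+ n)) i = sec g (i - n%:R)%R.
Proof.
rewrite /conjg !secM secV !sec_xX invg1 mul1g mulg1; congr (sec g _).
by rewrite rtV; apply: (@perm_inj _ (rt (x ^+ n))); rewrite permKV rt_xX subrK.
Qed.

Lemma rtJ1 g h : rt g = 1 -> rt (g ^ h) = 1.
Proof. by move=> g1; rewrite rtJ g1 conj1g. Qed.

Lemma Gamma_xX n : Gamma (x ^+ n). Proof. by apply: (subX sub_Gamma); exact: Gamma_x. Qed.
Lemma Gamma_gammaJ n : Gamma (gam ^ (x ^+ n)).
Proof. by apply: (subJ sub_Gamma); [exact: Gamma_gamma | exact: Gamma_xX]. Qed.

(** Gamma is self-replicating: among the conjugates of [gamma] by powers of [x], one has section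
    [gamma] at [i] and another has section [x]. *)
Lemma Gamma_proj (i : 'Z_3) g : Gamma g -> exists s, [/\ Gamma s, rt s = 1 & sec s i = g].
Proof.
move: g; apply: gen_ind => [|s [->|->]|g h _ _ [s [Gs s1 <-]] [s' [Gs' s1' <-]]|g _ [s [Gs s1 <-]]].
- by exists 1; split=> //; exact: (sub1 sub_Gamma).
- exists (gam ^ (x ^+ (i - 1)%R)); split; [exact: Gamma_gammaJ | exact: rtJ1 |].
  by rewrite secJxX natr_Zp (_ : (i - (i - 1))%R = 1%R) //; ring.
- exists (gam ^ (x ^+ i)); split; [exact: Gamma_gammaJ | exact: rtJ1 |].
  by rewrite secJxX natr_Zp subrr.
- exists (s * s'); split; first exact: (subM sub_Gamma).
    by rewrite rtM s1 s1' mulg1.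
  by rewrite secM s1 perm1.
- exists s^-1; split; first exact: (subV sub_Gamma).
    by rewrite rtV s1 invg1.
  by rewrite secV s1 invg1 perm1.
Qed.

Definition single (n : W) : W := mk (fun j : 'Z_3 => if j == 0%R then n else 1) 1.
Lemma rt_single n : rt (single n) = 1. Proof. by []. Qed.
Lemma sec_single n j : sec (single n) j = if j == 0%R :> 'Z_3 then n else 1. Proof. by []. Qed.

Ltac gnorm := rewrite /commg /conjg ?invgM ?invgK !mulgA;
  repeat first [rewrite mulgK | rewrite mulgVK | rewrite mulVg | rewrite mulgV | rewrite mul1g | rewrite mulg1].

(* This turns out to be the derived subgroup of [Gamma]: see [NC_ab] and [NC_intro]. *)
Definition NC : wset := fun n => Gamma n /\ Gamma (single n).

Lemma singleM m n : single (m * n) = single m * single n.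
Proof.
apply: Wext => [|i]; first by rewrite rtM !rt_single mulg1.
by rewrite secM rt_single perm1 !sec_single; case: ifP; rewrite ?mulg1.
Qed.
Lemma singleV n : single n^-1 = (single n)^-1.
Proof.
apply: Wext => [|i]; first by rewrite rtV !rt_single invg1.
by rewrite secV rt_single invg1 perm1 !sec_single; case: ifP; rewrite ?invg1.
Qed.
Lemma single1 : single 1 = 1.
Proof. by apply: Wext => [//|i]; rewrite sec_single; case: ifP. Qed.

Lemma sub_NC : is_subgroup NC.
Proof.
split; [|split].
- by split; rewrite ?single1; exact: (sub1 sub_Gamma).
- by move=> m n [Gm sm] [Gn sn]; split; rewrite wmulE ?singleM; exact: (subM sub_Gamma).
- by move=> m [Gm sm]; split; rewrite winvE ?singleV; exact: (subV sub_Gamma).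
Qed.

(** An element of Gamma fixing the first level with section [g] at 0 conjugates [single n] to
    [single (n ^ g)]. *)
Lemma NC_J n g : NC n -> Gamma g -> NC (n ^ g).
Proof.
move=> [Gn sn] Gg; split; first exact: (subJ sub_Gamma).
have [s [Gs s1 se]] := Gamma_proj 0%R Gg.
rewrite (_ : single _ = single n ^ s); first exact: (subJ sub_Gamma).
apply: Wext => [|i]; first by rewrite rtJ1.
by rewrite secJ1 // !sec_single; case: eqP => [->|]; rewrite ?se ?conj1g.
Qed.

Lemma NC_Jr n g : Gamma g -> NC (n ^ g) -> NC n.
Proof. by move=> Gg /NC_J -/(_ g^-1 (subV sub_Gamma Gg)); rewrite conjgK. Qed.

Lemma x_inv : x^-1 = x ^+ 2. Proof. exact: exp3V x3. Qed.
Lemma gamma_inv : gam^-1 = gam ^+ 2. Proof. exact: exp3V gamma3. Qed.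

(* [[gamma x^-1, gamma x]] is the first coordinate of a commutator in the stabilizer of the first
   level whose other coordinates are trivial; it generates the derived subgroup normally. *)
Lemma NC_commutator : NC [~ gam * x^-1, gam * x].
Proof.
have [Gg Gx] := (Gamma_gamma, Gamma_x); have Gx1 := subV sub_Gamma Gx.
have sR g h : Gamma g -> Gamma h -> Gamma [~ g, h].
  by move=> Gg' Gh'; apply: (subM sub_Gamma); [exact: (subV sub_Gamma) | exact: (subJ sub_Gamma)].
split; first by apply: sR; exact: (subM sub_Gamma).
rewrite (_ : single _ = [~ gam * gam ^ (x ^+ 1), gam * gam ^ (x ^+ 2)]).
  by apply: sR; apply: (subM sub_Gamma) => //; exact: Gamma_gammaJ.
have r1 n : rt (gam * gam ^ (x ^+ n)) = 1 by rewrite rtM rtJ1 // rt_gamma mulg1.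
apply: Wext => [|i].
  by rewrite rt_single /commg rtM rtV rtJ1 // r1 invg1 mulg1.
have s1 n j : sec (gam * gam ^ (x ^+ n)) j = sec gam j * sec gam (j - n%:R)%R.
  by rewrite secM secJxX rt_gamma perm1.
rewrite sec_single /commg secM rtV secV r1 invg1 !perm1 secJ1 // !s1.
have e1 : (0 - 1%:R)%R = 2%:R%R :> 'Z_3 by z3.
have e2 : (0 - 2%:R)%R = 1%R :> 'Z_3 by z3.
have e3 : (1 - 2%:R)%R = 2%:R%R :> 'Z_3 by z3.
have e4 : (2%:R - 1%:R)%R = 1%R :> 'Z_3 by z3.
by move: i; apply: I3P => /=; rewrite ?(e1, e2, e3, e4) ?subrr !sec_gamma ?mulgV ?mulVg ?conjg1 ?conj1g ?invg1 ?mulg1 ?mulVg.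
Qed.

(** Since x^-1 = x^2, the inverse of the commutator in [NC_commutator] is [gamma x, gamma x x] =
    [gamma, x]^x. *)
Lemma NC_x_gamma : NC [~ x, gam].
Proof.
have [Gg Gx] := (Gamma_gamma, Gamma_x).
rewrite -invgR; apply: (subV sub_NC).
have Gx1 : Gamma x^-1 by exact: (subV sub_Gamma).
apply: (@NC_Jr _ x) => //.
rewrite (_ : _ ^ x = [~ gam * x^-1, gam * x] ^-1); first by apply: (subV sub_NC); exact: NC_commutator.
rewrite invgR (_ : gam * x^-1 = gam * x * x); last by rewrite -mulgA x_inv.
by gnorm.
Qed.

Lemma NC_comm j k : NC [~ x ^+ j, gam ^+ k].
Proof.
have commXN n g h : Gamma g -> Gamma h -> NC [~ g, h] -> NC [~ g ^+ n, h].
  move=> Gg Gh cgh; elim: n => [|n IH]; first by rewrite comm1g; exact: (sub1 sub_NC).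
  rewrite (_ : [~ _, _] = [~ g, h] ^ (g ^+ n) * [~ g ^+ n, h]).
    by apply: (subM sub_NC) => //; apply: NC_J => //; exact: (subX sub_Gamma).
  by rewrite expgS; gnorm.
have [Gg Gx] := (Gamma_gamma, Gamma_x).
rewrite -invgR; apply: (subV sub_NC); apply: (commXN) => //; first exact: Gamma_xX.
rewrite -invgR; apply: (subV sub_NC); exact: commXN NC_x_gamma.
Qed.

Lemma Gamma_normal_form g : Gamma g -> exists i j n, NC n /\ g = gam ^+ i * x ^+ j * n.
Proof.
pose F g := exists i j n, NC n /\ g = gam ^+ i * x ^+ j * n; rewrite -/(F g).
have FN n : NC n -> F n by move=> Nn; exists 0, 0, n; split=> //; rewrite !mul1g.
have Fg n : F (gam ^+ n).
  by exists n, 0, 1; split; [exact: (sub1 sub_NC) | rewrite !mulg1].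
have Fx n : F (x ^+ n).
  by exists 0, n, 1; split; [exact: (sub1 sub_NC) | rewrite mulg1 mul1g].
have FM g' h : F g' -> F h -> F (g' * h).
  move=> [i [j [n [Nn ->]]]] [k [l [m [Nm ->]]]].
  exists (i + k)%N, (j + l)%N, ([~ x ^+ j, gam ^+ k] ^ (x ^+ l) * n ^ (gam ^+ k * x ^+ l) * m).
  split; last by rewrite !expgnDr; gnorm.
  have Gg := subX sub_Gamma k Gamma_gamma.
  apply: (subM sub_NC) => //; apply: (subM sub_NC); apply: NC_J => //; try exact: Gamma_xX.
    exact: NC_comm.
  by apply: (subM sub_Gamma) => //; exact: Gamma_xX.
move: g; apply: gen_ind => [|s [->|->]|g h _ _|g Gg [i [j [n [Nn ->]]]]].
- by apply: FN; exact: (sub1 sub_NC).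
- exact: (Fx 1%N).
- exact: (Fg 1%N).
- exact: FM.
- rewrite !invgM -!expVgn x_inv gamma_inv -!expgnA.
  by apply: (FM); [apply: FN; exact: (subV sub_NC) | exact: FM].
Qed.

Lemma kappaE g i : kappa g i = (b (sec g i) - a (sec g (i + 2%:R)%R) + a (sec g (i + 1)%R))%R.
Proof. by []. Qed.

(** Both exponents occur in [kappa (single g)], which vanishes on Gamma: index 0 gives [b g] and
    index 1 gives [- a g]. *)
Lemma NC_ab g : NC g -> a g = 0%R /\ b g = 0%R.
Proof.
move=> [Gg sg].
have := kappa_Gamma 0%R sg; have := kappa_Gamma 1%R sg; rewrite !kappaE !sec_single /= b1 (addf1 sub_B a_B).
by rewrite subr0 !addr0 sub0r => /eqP; rewrite oppr_eq0 => /eqP.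
Qed.

Lemma NC_intro g : Gamma g -> a g = 0%R -> b g = 0%R -> NC g.
Proof.
move=> Gg; have [i [j [n [Nn ->]]]] := Gamma_normal_form Gg.
have [an bn] := NC_ab Nn; have Bn : B n by apply: Gamma_B; case: Nn.
have Bg := subX sub_B i B_gamma; have Bx := subX sub_B j B_x.
have Bgx := subM sub_B Bg Bx.
rewrite !a_B // !b_B // an bn !(addfX sub_B a_B) ?(addfX sub_B b_B); try solve [exact: B_x | exact: B_gamma].
rewrite a_gamma b_gamma a_x b_x !mulr0 !addr0 add0r !mulr1 => i0 j0.
by rewrite (exp3_mod i gamma3) (exp3_mod j x3) i0 j0 !mul1g.
Qed.

Lemma NC_Gamma n : NC n -> Gamma n. Proof. by case. Qed.

(** Gamma contains three independent copies of [NC], as conjugation by [x] moves [single] to the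
    other coordinates. *)
Lemma Gamma_mk f : (forall i, NC (f i)) -> Gamma (mk f 1).
Proof.
move=> Nf; rewrite (_ : mk f 1 = single (f 0%R) * single (f 1%R) ^ (x ^+ 1) * single (f 2%:R%R) ^ (x ^+ 2)).
  have sf i : Gamma (single (f i)) by case: (Nf i).
  have sfJ i n : Gamma (single (f i) ^ (x ^+ n)) by apply: (subJ sub_Gamma) => //; exact: Gamma_xX.
  by apply: (subM sub_Gamma) => //; exact: (subM sub_Gamma).
apply: Wext => [|i]; first by rewrite 2!rtM !rtJ1 // !mulg1.
rewrite 2!secM rtM !rtJ1 // !rt_single mulg1 !perm1 !secJxX !sec_single sec_mk.
by move: i; apply: I3P => /=; rewrite ?mul1g ?mulg1.
Qed.

(* The witness is [gamma^(al 0) (gamma^x)^(al 1) (gamma^(x^2))^(al 2)]. *)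
Lemma Gamma_stab (al : 'Z_3 -> 'Z_3) : exists k, [/\ Gamma k, rt k = 1,
  forall i, a (sec k i) = al i & forall i, al i = 0%R -> exists n, sec k i = x ^+ n].
Proof.
pose c (i : 'Z_3) := (gam ^ (x ^+ i)) ^+ al i.
have Gc i : Gamma (c i) by apply: (subX sub_Gamma); exact: Gamma_gammaJ.
have rc i : rt (c i) = 1 by rewrite rtX rtJ1 // expg1n.
have sc i j : sec (c i) j = sec gam (j - i)%R ^+ al i by rewrite secX ?rtJ1 // secJxX natr_Zp.
have skE i : sec (c 0%R * c 1%R * c 2%:R%R) i = sec (c 0%R) i * sec (c 1%R) i * sec (c 2%:R%R) i.
  by rewrite 2!secM rtM !rc mulg1 !perm1.
have sB i j : B (sec (c i) j) by apply: B_sec; exact: Gamma_B.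
exists (c 0%R * c 1%R * c 2%:R%R); split.
- by do 2?apply: (subM sub_Gamma).
- by rewrite 2!rtM !rc !mulg1.
- move=> i; rewrite skE !a_B //; last exact: (subM sub_B).
  have ac j : a (sec (c j) i) = (if j == i then al i else 0)%R.
    rewrite sc (addfX sub_B a_B); last by apply: B_sec; exact: B_gamma.
    have -> : a (sec gam (i - j)%R) = (if j == i then 1 else 0)%R.
      rewrite -subr_eq0 -opprB oppr_eq0; move: (i - j)%R; apply: I3P;
      by rewrite sec_gamma ?a_gamma ?a_x ?a_xV.
    by case: eqP => [->|]; rewrite ?mulr1 ?mulr0 ?natr_Zp.
  by rewrite !ac; move: i {ac}; apply: I3P; rewrite /= ?addr0 ?add0r.
- move=> i ali; rewrite skE.
  have /choice[f fE] : forall j, exists n, sec (c j) i = x ^+ n.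
    move=> j; rewrite sc; have [->|] := eqVneq j i; first by exists 0; rewrite ali.
    rewrite -subr_eq0 -opprB oppr_eq0; move: (i - j)%R; apply: I3P => // _; rewrite sec_gamma.
      by exists (al j).
    by exists (2 * al j)%N; rewrite expgnA x_inv.
  by exists (f 0%R + f 1%R + f 2%:R%R)%N; rewrite !fE !expgnDr.
Qed.

Lemma b_xX n : b (x ^+ n) = n%:R%R.
Proof. by rewrite (addfX sub_B b_B n B_x) b_x mulr1. Qed.

Lemma kappa_sec g h : (forall i, a (sec g i) = a (sec h i)) -> (forall i, b (sec g i) = b (sec h i)) ->
  forall i, kappa g i = kappa h i.
Proof. by move=> ea eb i; rewrite !kappaE !ea !eb. Qed.

(** [Gamma_stab] gives [k] in Gamma whose sections have the same gamma-exponents as those of [g]. As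
    [kappa] vanishes on both, the x-exponents agree too, so the sections differ by elements of
    [NC]. *)
Lemma Gamma_crit g : even (rt g) -> (forall i, Gamma (sec g i)) -> (forall i, kappa g i = 0%R) -> Gamma g.
Proof.
move=> eg Gs k0; have [k [Gk rk ak _]] := Gamma_stab (fun i => a (sec g i)).
have bk i : b (sec k i) = b (sec g i).
  have := k0 i; have := kappa_Gamma i Gk; rewrite !kappaE !ak.
  by move: (b (sec k i)) (b (sec g i)) (a _) (a _); z3.
pose m := mk (fun i => sec g i * (sec k i)^-1) 1.
have Gm : Gamma m.
  apply: Gamma_mk => i; have Gki := Gamma_sec i Gk; have Gki' := subV sub_Gamma Gki.
  have [Bg Bk Bk'] := And3 (Gamma_B (Gs i)) (Gamma_B Gki) (Gamma_B Gki').
  apply: NC_intro; first exact: (subM sub_Gamma).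
    by rewrite a_B // (addfV sub_B a_B) // ak subrr.
  by rewrite b_B // (addfV sub_B b_B) // bk subrr.
rewrite (_ : g = m * k * x ^+ (b g)).
  by apply: (subM sub_Gamma); [exact: (subM sub_Gamma) | exact: Gamma_xX].
apply: Wext => [|i].
  rewrite !rtM rt_mk rk !mul1g; apply/permP => i.
  by rewrite rt_xX natr_Zp rtE.
by rewrite secMxX secM rt_mk perm1 sec_mk mulgVK.
Qed.

(** * Normalizers, and the structure of B over Gamma *)

Lemma normalizerE H g : normalizer H g <-> forall h, H h <-> H (h ^ g).
Proof. by rewrite /normalizer; split=> N h; move: (N h); rewrite /conjg mulgA. Qed.

Lemma normalizer_intro H g : (forall h, H h -> H (h ^ g)) -> (forall h, H h -> H (h ^ g^-1)) -> normalizer H g.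
Proof.
move=> H1 H2; apply/normalizerE => h; split; first exact: H1.
by move/H2; rewrite conjgK.
Qed.

Lemma normalizerJ H g h : normalizer H g -> H h -> H (h ^ g).
Proof. by move/normalizerE => N; case: (N h). Qed.

Lemma sub_normalizer H : is_subgroup (normalizer H).
Proof.
split; [|split].
- by apply/normalizerE => h; rewrite conjg1.
- move=> g h /normalizerE Ng /normalizerE Nh; apply/normalizerE => k.
  by rewrite wmulE conjgM; apply: (iff_trans (Ng k)); exact: Nh.
- by move=> g /normalizerE N; apply/normalizerE => h; rewrite (N (h ^ _)) conjgKV.
Qed.

Lemma normalizer_sub H g : is_subgroup H -> H g -> normalizer H g.
Proof.
move=> sH Hg; apply: normalizer_intro => h Hh; apply: (subJ sH) => //; exact: (subV sH).
Qed.

Lemma normalizerJV H g h : normalizer H g -> H h -> H (h ^ g^-1).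
Proof. by move/(subV (sub_normalizer H)); exact: normalizerJ. Qed.

Lemma gen_J (S K : wset) g : is_subgroup K -> (forall s, S s -> K (s ^ g)) -> forall h, gen S h -> K (h ^ g).
Proof.
move=> sK SK; apply: gen_ind => // [|h k _ _ Kh Kk|h _ Kh].
- by rewrite conj1g; exact: (sub1 sK).
- by rewrite conjMg; exact: (subM sK).
- by rewrite conjVg; exact: (subV sK).
Qed.

Lemma gen_J_normalizer S g : (forall s, S s -> gen S (s ^ g)) -> (forall s, S s -> gen S (s ^ g^-1)) ->
  normalizer (gen S) g.
Proof. by move=> H1 H2; apply: normalizer_intro; [exact: (gen_J (sub_gen S) H1) | exact: (gen_J (sub_gen S) H2)]. Qed.

(** Conjugation by Delta w fixes the sections x and x^-1 of gamma and replaces gamma by gamma^w. It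
    preserves the exponents of the sections, hence [kappa], and [Gamma_crit] applies. *)
Lemma Uh_gamma w : Uh w -> Gamma (gam ^ w).
Proof.
elim=> [|n {}w Uw IH]; first by rewrite conjg1; exact: Gamma_gamma.
rewrite commute_xX_Delta conjgM; apply: (subJ sub_Gamma); last exact: Gamma_xX.
have [xw xVw] : x ^ w = x /\ x^-1 ^ w = x^-1.
  by rewrite conjVg; have := UhJ (Uh_x 1) Uw; rewrite expg1 => ->.
have sE i : sec (gam ^ Delta w) i = sec gam i ^ w by rewrite secJ1 // sec_Delta.
have Bw := Uh_B Uw.
apply: Gamma_crit => [|i|i].
- by rewrite rtJ1 //; exact: even1.
- by rewrite sE; move: i; apply: I3P; rewrite sec_gamma ?xw ?xVw //;
   [exact: Gamma_x | apply: (subV sub_Gamma); exact: Gamma_x].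
- rewrite (@kappa_sec _ gam) ?kappa_gamma // => j; rewrite sE.
    by rewrite (addfJ sub_B a_B) //; apply: B_sec; exact: B_gamma.
  by rewrite (addfJ sub_B b_B) //; apply: B_sec; exact: B_gamma.
Qed.

Lemma Uh_normalizer w : Uh w -> normalizer Gamma w.
Proof.
have H v : Uh v -> forall s, s = x \/ s = gam -> Gamma (s ^ v).
  move=> Uv s [->|->]; last exact: Uh_gamma.
  by have := UhJ (Uh_x 1) Uv; rewrite expg1 => ->; exact: Gamma_x.
by move=> Uw; apply: gen_J_normalizer; apply: H => //; exact: UhV.
Qed.

Lemma NC_J_Uh n w : NC n -> Uh w -> NC (n ^ w).
Proof.
move=> Nn Uw; have [a0 b0] := NC_ab Nn; have Gn := NC_Gamma Nn.
have [Bn Bw] := (Gamma_B Gn, Uh_B Uw).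
apply: NC_intro; first exact: normalizerJ (Uh_normalizer Uw) Gn.
  by rewrite (addfJ sub_B a_B).
by rewrite (addfJ sub_B b_B).
Qed.

Lemma B_decomp g : B g -> exists k w, [/\ Gamma k, Uh w & g = k * Delta w].
Proof.
move: g; apply: gen_ind => [|s [->|[[|n] ->]]|g h _ _ [k [w [Gk Uw ->]]] [k' [w' [Gk' Uw' ->]]]|g _ [k [w [Gk Uw ->]]]].
- by exists 1, 1; split; [exact: (sub1 sub_Gamma) | exact: Uh1 | rewrite Delta1 mulg1].
- by exists gam, 1; split; [exact: Gamma_gamma | exact: Uh1 | rewrite Delta1 mulg1].
- by exists x, 1; split; [exact: Gamma_x | exact: Uh1 | rewrite Delta1 mulg1].
- by exists 1, (xn n); split; [exact: (sub1 sub_Gamma) | exact: Uh_xn | rewrite mul1g].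
- exists (k * k' ^ (Delta w)^-1), (w * w'); split.
  + apply: (subM sub_Gamma) => //; exact: (normalizerJV (Uh_normalizer (Uh_Delta Uw)) Gk').
  + exact: UhM.
  + by rewrite DeltaM; gnorm.
- exists (k^-1 ^ Delta w), w^-1; split.
  + exact: (normalizerJ (Uh_normalizer (Uh_Delta Uw)) (subV sub_Gamma Gk)).
  + exact: UhV.
  + by rewrite DeltaV; gnorm.
Qed.

(** In the decomposition k Delta(w), the exponents [beta n.+1] ignore [k] and are exactly the
    exponents of [w]. *)
Lemma B_Gamma g : B g -> (forall n, beta n.+1 g = 0%R) -> Gamma g.
Proof.
move=> Bg H; have [k [w [Gk Uw eg]]] := B_decomp Bg.
suff w1 : w = 1 by rewrite eg w1 Delta1 mulg1.
have [Bk BD] := (Gamma_B Gk, Uh_B (Uh_Delta Uw)).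
by apply: Uh_eq1 => // n; rewrite -(H n) eg beta_B // beta_Delta beta_Gamma // add0r.
Qed.

(** When the gamma-exponent is 0, the Gamma factor [k] is x^(b k) modulo [NC], and this power joins
    the factor in [Uh]. *)
Lemma B_split g : B g -> a g = 0%R -> exists w n, [/\ Uh w, NC n & g = w * n].
Proof.
move=> Bg ag; have [k [w [Gk Uw eg]]] := B_decomp Bg.
have UD := Uh_Delta Uw; have [Bk BD] := (Gamma_B Gk, Uh_B UD).
exists (x ^+ (b k) * Delta w), ((x ^- (b k) * k) ^ Delta w); split; first exact: UhS.
  have Gx := subV sub_Gamma (Gamma_xX (b k)); have [Bx Bx'] := (Gamma_B (Gamma_xX (b k)), Gamma_B Gx).
  apply: NC_J_Uh => //; apply: NC_intro; first exact: (subM sub_Gamma).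
    rewrite a_B // (addfV sub_B a_B) // (addfX sub_B a_B) ?a_x; last exact: B_x.
    by move: ag; rewrite eg a_B // a_Delta addr0 => ->; rewrite mulr0 oppr0 addr0.
  by rewrite b_B // (addfV sub_B b_B) // b_xX natr_Zp addNr.
by rewrite eg; gnorm.
Qed.

(* Right multiplication by [Gamma] makes the sections of [g] congruent modulo [Uh]. *)
Lemma reduce_sections g i : rt g = 1 -> (forall j, B ((sec g i)^-1 * sec g j)) ->
  exists k n (w : 'Z_3 -> W), [/\ Gamma k, rt k = 1, forall j, Uh (w j), w i = 1
    & forall j, sec (g * k) j = sec g i * x ^+ n * w j].
Proof.
move=> rg BP; pose P j := (sec g i)^-1 * sec g j.
(* The exponents are chosen opposite to those of [P j], so that every [Q j] below has gamma-exponent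
   0 and splits by [B_split]. At [i] the section of [k] is a power of [x], which [x ^- n]
   cancels. *)
have [k [Gk rk ak sk]] := Gamma_stab (fun j => - a (P j))%R.
have Pi : P i = 1 by rewrite /P mulVg.
have [n kn] : exists n, sec k i = x ^+ n by apply: sk; rewrite Pi (addf1 sub_B a_B) oppr0.
pose Q j := x ^- n * P j * sec k j.
have Bk j : B (sec k j) by apply: B_sec; exact: Gamma_B.
have Bx := Gamma_B (Gamma_xX n); have Bx' := subV sub_B Bx.
have BxP j : B (x ^- n * P j) := subM sub_B Bx' (BP j).
have BQ j : B (Q j) := subM sub_B (BxP j) (Bk j).
have aQ j : a (Q j) = 0%R.
  rewrite a_B // (a_B Bx' (BP j)) ak (addfV sub_B a_B) // (addfX sub_B a_B); last exact: B_x.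
  by rewrite a_x mulr0 oppr0 add0r subrr.
have /choice[wm wmP] : forall j, exists p : W * W,
    [/\ Uh p.1, NC p.2, Q j = p.1 * p.2 & j = i -> p = (1, 1)].
  move=> j; have [->|ne] := eqVneq j i.
    exists (1, 1); split=> //=; [exact: Uh1 | exact: (sub1 sub_NC) |].
    by rewrite /Q Pi mulg1 kn mulg1 mulVg.
  have [w [m [Uw Nm eQ]]] := B_split (BQ j) (aQ j); exists (w, m); split=> // eji.
  by rewrite eji eqxx in ne.
(* The [NC] parts left in the sections are removed together by one element of Gamma. *)
pose l := mk (fun j => (wm j).2^-1) 1.
have Gl : Gamma l by apply: Gamma_mk => j; apply: (subV sub_NC); case: (wmP j).
exists (k * l), n, (fun j => (wm j).1); split=> [|||| j].
- exact: (subM sub_Gamma).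
- by rewrite rtM rk mul1g.
- by move=> j; case: (wmP j).
- by case: (wmP i) => _ _ _ /(_ erefl) ->.
- have [_ _ eQ _] := wmP j.
  have -> : (wm j).1 = Q j * (wm j).2^-1 by rewrite eQ mulgK.
  by rewrite !secM rg rk !perm1 sec_mk /Q /P !mulgA mulgK mulgV mul1g.
Qed.

(** * The normalizer of Gamma *)

Lemma Gamma_DeltaGamma : Gamma (Delta gam).
Proof.
apply: Gamma_crit => [|i|i]; first exact: even1.
  by rewrite sec_Delta; exact: Gamma_gamma.
by rewrite kappa_Delta b_gamma.
Qed.

Lemma B_Delta h : B h -> B (Delta h).
Proof.
move: h; apply: gen_ind => [|s [->|[n ->]]|g h _ _ Bg Bh|g _ Bg].
- by rewrite Delta1; exact: (sub1 sub_B).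
- by apply: Gamma_B; exact: Gamma_DeltaGamma.
- by rewrite -xnS; exact: B_xn.
- by rewrite DeltaM; exact: (subM sub_B).
- by rewrite DeltaV; exact: (subV sub_B).
Qed.

(** * The action of V, and the group A *)

Lemma V1 : V 1. Proof. by left. Qed.
Lemma V_tau1 : V (tau 1). Proof. by right; left. Qed.
Lemma V_tau2 : V (tau 2). Proof. by right; right; left. Qed.
Lemma V_tau3 : V (tau 3). Proof. by do 3!right. Qed.
Lemma VM u v : V u -> V v -> V (u * v).
Proof.
by move=> [->|[->|[->|->]]] [->|[->|[->|->]]]; rewrite /V ?mul1g ?mulg1 ?tauE; tauto.
Qed.
Lemma V_inv v : V v -> v^-1 = v.
Proof. by move=> [->|[->|[->|->]]]; rewrite ?invg1 ?tauE. Qed.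
Lemma sub_V : is_subgroup V.
Proof. by split; [exact: V1 | split; [exact: VM | move=> v Vv; rewrite winvE V_inv]]. Qed.

Lemma V_normalizer_gen S v : (forall s u, S s -> V u -> gen S (s ^ u)) -> V v -> normalizer (gen S) v.
Proof. by move=> H Vv; apply: gen_J_normalizer => s Ss; apply: H => //; rewrite V_inv. Qed.

Lemma Uh_tau1 w : Uh w -> w ^ tau 1 = w^-1.
Proof.
elim=> [|n {}w Uw IH]; first by rewrite conj1g invg1.
rewrite conjMg conjXg x_tau1 Delta_tau1 IH DeltaV expVgn -invgM.
by rewrite -commute_xX_Delta.
Qed.

Lemma Uh_tau23 w : Uh w -> Uh (w ^ tau 2) /\ Uh (w ^ tau 3).
Proof.
elim=> [|n {}w Uw [U2 U3]]; first by rewrite !conj1g; split; exact: Uh1.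
rewrite !conjMg !conjXg x_tau2 x_tau3 Delta_tau2 Delta_tau3 x_inv -expgnA.
by split; exact: UhS.
Qed.
Lemma Uh_V w v : Uh w -> V v -> Uh (w ^ v).
Proof.
move=> Uw; have [U2 U3] := Uh_tau23 Uw.
by move=> [->|[->|[->|->]]] //; [rewrite conjg1 | rewrite Uh_tau1 //; exact: UhV].
Qed.

(** [tau 2] fixes [x] and acts below as [tau 3], which inverts [x] and acts below as [tau 2]; hence
    the alternating signs, and the role of odd exponents in [T]. *)
Lemma beta_tau23 w n : Uh w ->
  beta n (w ^ tau 2) = (if odd n then - beta n w else beta n w)%R /\
  beta n (w ^ tau 3) = (if odd n then beta n w else - beta n w)%R.
Proof.
move=> Uw; elim: Uw n => [n|m {}w Uw IH n].
  by rewrite !conj1g beta1 oppr0; split; case: odd.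
have [U2 U3] := Uh_tau23 Uw.
rewrite !conjMg !conjXg x_tau2 x_tau3 Delta_tau2 Delta_tau3 x_inv -expgnA !beta_UhS //.
case: n => [|n] /=; first by split=> //; move: (m : nat) => k; rewrite natrM; move: (k%:R)%R; z3.
by have [-> ->] := IH n; case: odd.
Qed.

Lemma x_V v : V v -> x ^ v = x \/ x ^ v = x^-1.
Proof. by move=> [->|[->|[->|->]]]; rewrite ?conjg1 ?x_tau1 ?x_tau2 ?x_tau3; auto. Qed.
Lemma gamma_V v : V v -> gam ^ v = gam \/ gam ^ v = gam^-1.
Proof. by move=> [->|[->|[->|->]]]; rewrite ?conjg1 ?gamma_tau1 ?gamma_tau2 ?gamma_tau3; auto. Qed.

Lemma V_Gamma v : V v -> normalizer Gamma v.
Proof.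
apply: V_normalizer_gen => s u [->|->] Vu.
  by case: (x_V Vu) => ->; [|apply: (subV sub_Gamma)]; exact: Gamma_x.
by case: (gamma_V Vu) => ->; [|apply: (subV sub_Gamma)]; exact: Gamma_gamma.
Qed.
Lemma V_B v : V v -> normalizer B v.
Proof.
apply: V_normalizer_gen => s u [->|[n ->]] Vu.
  by case: (gamma_V Vu) => ->; [|apply: (subV sub_B)]; exact: B_gamma.
by apply: Uh_B; apply: Uh_V => //; exact: Uh_xn.
Qed.

Lemma sub_setmul H K : is_subgroup H -> is_subgroup K -> (forall k, K k -> normalizer H k) ->
  is_subgroup (setmul H K).
Proof.
move=> sH sK N; split; [|split].
- by exists 1, 1; split; [exact: (sub1 sH) | split; [exact: (sub1 sK) | rewrite wmulE mulg1]].
- move=> _ _ [h [k [Hh [Kk ->]]]] [h' [k' [Hh' [Kk' ->]]]]; exists (h * h' ^ k^-1), (k * k'); split; [|split].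
  + by apply: (subM sH) => //; exact: normalizerJV (N _ Kk) Hh'.
  + exact: (subM sK).
  + by rewrite !wmulE; gnorm.
- move=> _ [h [k [Hh [Kk ->]]]]; exists (h^-1 ^ k), k^-1; split; [|split].
  + exact: normalizerJ (N _ Kk) (subV sH Hh).
  + exact: (subV sK).
  + by rewrite winvE !wmulE; gnorm.
Qed.

(* [A] and [C] are the second and third terms of the tower; [B] and [D] are their subgroups
   generated by the elements of order 3. *)
Definition A : wset := setmul B V.
Lemma sub_A : is_subgroup A. Proof. exact: sub_setmul sub_B sub_V V_B. Qed.
Lemma B_A g : B g -> A g. Proof. by exists g, 1; split=> //; split; [exact: V1 | rewrite wmulE mulg1]. Qed.
Lemma V_A v : V v -> A v.
Proof. by exists 1, v; split; [exact: (sub1 sub_B) | split=> //; rewrite wmulE mul1g]. Qed.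

(** Conjugation by an element fixing the first level commutes with taking sections of such elements:
    lift to [S], conjugate there and project. *)
Lemma proj_normalizer (S S' : wset) g i : normalizer S g -> rt g = 1 -> (forall s, S s -> S' (sec s i)) ->
  (forall y, S' y -> exists s, [/\ S s, rt s = 1 & sec s i = y]) -> normalizer S' (sec g i).
Proof.
move=> Ng rg SS' pS.
have rgV : rt g^-1 = 1 by rewrite rtV rg invg1.
have sgV : sec g^-1 i = (sec g i)^-1 by rewrite secV rg invg1 perm1.
apply: normalizer_intro => y /pS[s [Ss rs <-]].
  by rewrite -secJ1 //; apply: SS'; exact: normalizerJ.
by rewrite -sgV -secJ1 //; apply: SS'; exact: normalizerJV.
Qed.

Lemma proj_Gamma g i : normalizer Gamma g -> rt g = 1 -> normalizer Gamma (sec g i).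
Proof. by move=> Ng rg; apply: proj_normalizer Ng rg _ (@Gamma_proj i) => s; exact: Gamma_sec. Qed.

Lemma sec_xJ g (i : 'Z_3) : rt g = 1 -> sec (x ^ g) i = (sec g i)^-1 * sec g (i + 1)%R.
Proof. by move=> rg; rewrite secJ // sec_x mul1g rt_x cycE. Qed.

Lemma B_diff g : (forall i, B ((sec g i)^-1 * sec g (i + 1)%R)) ->
  forall i j, B ((sec g i)^-1 * sec g j).
Proof.
move=> H i j; rewrite -[j](subrK i) addrC; move: (j - i)%R; apply: I3P.
- by rewrite addr0 mulVg; exact: (sub1 sub_B).
- exact: H.
- have := subM sub_B (H i) (H (i + 1)%R); rewrite -addrA.
  by rewrite mulgA mulgK.
Qed.

(** In reduced form the sections of x^(g k) are w_j^-1 w_(j+1), in [Uh]. Vanishing of [kappa] and of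
    all [beta n.+1] on Gamma makes them trivial, so w is constant, equal to w_i = 1. *)
Lemma reduce_Gamma g i : normalizer Gamma g -> rt g = 1 ->
  exists k n, [/\ Gamma k, rt k = 1 & g * k = Delta (sec g i * x ^+ n)].
Proof.
move=> Ng rg.
have Gd j : Gamma ((sec g j)^-1 * sec g (j + 1)%R).
  by rewrite -sec_xJ //; apply: Gamma_sec; exact: normalizerJ Ng Gamma_x.
have [k [n [w [Gk rk Uw wi sgk]]]] := reduce_sections rg (B_diff (fun j => Gamma_B (Gd j)) i).
exists k, n; split=> //.
have rgk : rt (g * k) = 1 by rewrite rtM rg rk mulg1.
have Ngk : normalizer Gamma (g * k).
  by apply: (subM (sub_normalizer Gamma)) => //; exact: normalizer_sub sub_Gamma Gk.
pose y j := (w j)^-1 * w (j + 1)%R.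
have Uy j : Uh (y j) by apply: UhM => //; exact: UhV.
have xgk := normalizerJ Ngk Gamma_x.
have sy j : sec (x ^ (g * k)) j = y j by rewrite sec_xJ // !sgk invgM -mulgA mulKg.
have y1 j : y j = 1.
  apply: Uh_eq1 => // -[|m]; last by rewrite -sy; apply: beta_Gamma; exact: Gamma_sec.
  have := kappa_Gamma j xgk; rewrite kappaE !sy !(Uh_a (Uy _)) subr0 addr0; exact.
have wS j : w (j + 1)%R = w j by apply: (mulgI (w j)^-1); rewrite mulVg; exact: y1.
have w1 j : w j = 1.
  rewrite -wi -[j](subrK i) addrC; move: (j - i)%R; apply: I3P; rewrite ?addr0 ?wS //.
  by rewrite (_ : i + 2%:R = i + 1 + 1)%R ?wS //; rewrite -addrA.
by apply: Wext => [//|j]; rewrite sgk sec_Delta w1 mulg1.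
Qed.

Lemma Delta_normalizer_sections h : normalizer Gamma (Delta h) -> normalizer Gamma h.
Proof. by move=> N; rewrite -(sec_Delta h 0%R); exact: proj_Gamma. Qed.

Lemma b_J_gamma g : b (gam ^ g) = 0%R.
Proof. by rewrite /b rtJ rt_gamma conj1g perm1. Qed.

Lemma sec_gammaJ_Delta h i : sec (gam ^ Delta h) i = sec gam i ^ h.
Proof. by rewrite secJ1 // sec_Delta. Qed.

(** The sections of gamma^(Delta h) are gamma^h, x^h and (x^h)^-1. Its [kappa] at 0 is 2 a(x^h), and
    at 1 it then reduces to b(x^h) - a(gamma^h). *)
Lemma Delta_normalizer_exponents h : normalizer Gamma (Delta h) ->
  a (x ^ h) = 0%R /\ b (x ^ h) = a (gam ^ h).
Proof.
move=> N; have Nh := Delta_normalizer_sections N.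
have Gx := normalizerJ Nh Gamma_x.
have GD := normalizerJ N Gamma_gamma.
have k0 := kappa_Gamma 0%R GD; have k1 := kappa_Gamma 1%R GD.
move: k0 k1; rewrite !kappaE add0r.
have -> : (1 + 1)%R = 2%:R%R :> 'Z_3 by z3.
have -> : (1 + 2%:R)%R = 0%R :> 'Z_3 by z3.
rewrite add0r !sec_gammaJ_Delta !sec_gamma conjVg (addfV sub_B a_B (Gamma_B Gx)) b_J_gamma.
by move: (a _) (b _) (a _); z3.
Qed.

(* The abelianization of [Gamma] is F_3^2, with coordinates [a] and [b]. *)
Definition N1 (h : W) := [/\ normalizer Gamma h, a (gam ^ h) = 1%R, a (x ^ h) = 0%R & b (x ^ h) = 1%R].

Lemma N1_mul_Gamma h k : N1 h -> Gamma k -> N1 (h * k).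
Proof.
move=> [Nh ag ax bx] Gk; have Bk := Gamma_B Gk.
have Bg := Gamma_B (normalizerJ Nh Gamma_gamma); have Bx := Gamma_B (normalizerJ Nh Gamma_x).
split.
- by apply: (subM (sub_normalizer Gamma)) => //; exact: normalizer_sub sub_Gamma Gk.
- by rewrite conjgM (addfJ sub_B a_B).
- by rewrite conjgM (addfJ sub_B a_B).
- by rewrite conjgM (addfJ sub_B b_B).
Qed.

Lemma N1_Delta h : N1 (Delta h) -> N1 h.
Proof.
move=> [N ag ax bx]; have [cx bE] := Delta_normalizer_exponents N.
have Nh := Delta_normalizer_sections N.
have ag1 : a (gam ^ h) = 1%R.
  by rewrite -bE -ag /a !sec_gammaJ_Delta !sec_gamma b_J_gamma subr0.
by split; rewrite // bE.
Qed.

(** * Syllable length and its contraction *)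

(* The exponent [e] may vanish, so [n] is only an upper bound on the syllable length. *)
Fixpoint L (n : nat) (g : W) : Prop :=
  if n is m.+1 then exists h e j, L m h /\ g = h * gam ^+ e * x ^+ j else exists j, g = x ^+ j.

Lemma L_S n g : L n g -> L n.+1 g.
Proof. by move=> Lg; exists g, 0%N, 0%N; rewrite !mulg1. Qed.
Lemma L_mulx n g j : L n g -> L n (g * x ^+ j).
Proof.
case: n => [[k ->]|n [h [e [k [Lh ->]]]]]; first by exists (k + j)%N; rewrite expgnDr.
by exists h, e, (k + j)%N; rewrite expgnDr !mulgA.
Qed.
Lemma LM m n g h : L m g -> L n h -> L (m + n) (g * h).
Proof.
elim: n h => [h Lg [j ->]|n IH h Lg [k [e [j [Lk ->]]]]]; first by rewrite addn0; exact: L_mulx.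
by rewrite addnS; exists (g * k), e, j; rewrite !mulgA; split=> //; exact: IH.
Qed.
Lemma L_x j : L 0 (x ^+ j). Proof. by exists j. Qed.
Lemma L_gamma e : L 1 (gam ^+ e).
Proof. by exists 1, e, 0%N; split; [exists 0%N | rewrite mulg1 mul1g]. Qed.
Lemma LV n g : L n g -> L n g^-1.
Proof.
elim: n g => [g [j ->]|n IH g [h [e [j [Lh ->]]]]].
  by rewrite -expVgn x_inv -expgnA; exact: L_x.
rewrite !invgM -!expVgn x_inv gamma_inv -!expgnA.
by have := LM (L_x (2 * j)) (LM (L_gamma (2 * e)) (IH _ Lh)).
Qed.
Lemma LJ m n g h : L m g -> L n h -> L (m + 2 * n) (g ^ h).
Proof.
move=> Lg Lh; have := LM (LV Lh) (LM Lg Lh).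
by rewrite (_ : n + (m + n) = m + 2 * n)%N //; lia.
Qed.
Lemma LJx n g j : L n g -> L n (g ^ (x ^+ j)).
Proof. by move=> Lg; rewrite -[n]addn0; exact: (LJ Lg (L_x j)). Qed.

Lemma Gamma_L g : Gamma g -> exists n, L n g.
Proof.
move: g; apply: gen_ind => [|s [->|->]|g h _ _ [m Lg] [n Lh]|g _ [n Lg]].
- by exists 0%N, 0%N.
- by exists 0%N, 1%N.
- by exists 1%N; exact: (L_gamma 1).
- by exists (m + n)%N; exact: LM.
- by exists n; exact: LV.
Qed.

Lemma L_B n g : L n g -> B g.
Proof.
elim: n g => [g [j ->]|n IH g [h [e [j [/IH Bh ->]]]]].
  by apply: Gamma_B; exact: Gamma_xX.
by apply: (subM sub_B); [apply: (subM sub_B) => //; apply: (subX sub_B); exact: B_gamma |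
  apply: (subX sub_B); exact: B_x].
Qed.

(** After a prefix with root translation [c], a syllable gamma^e contributes a syllable only to the
    section at the letter [i] with i + c = 0; the other sections receive powers of [x]. *)
Definition ind (c i : 'Z_3) : nat := (i + c == 0)%R.

Lemma L_sec_gamma (i : 'Z_3) e : L (i == 0%R) (sec gam i ^+ e).
Proof.
move: i; apply: I3P; rewrite sec_gamma; first exact: L_gamma.
  exact: L_x.
by rewrite x_inv -expgnA; exact: L_x.
Qed.

Lemma L_sec_step h m e j (i : 'Z_3) : even (rt h) -> L m (sec h i) ->
  L (m + ind (b h) i) (sec (h * gam ^+ e * x ^+ j) i).
Proof.
move=> eh Lh; rewrite secMxX secM secX // rtE //.
by apply: LM => //; exact: L_sec_gamma.
Qed.

Lemma sum_indicator (c : 'Z_3) :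
  (ind c 0%R + ind c 1%R + ind c 2%:R%R = 1)%N.
Proof. by move: c; apply: I3P. Qed.

Lemma L_sec n g : L n g -> exists l : 'Z_3 -> nat,
  (l 0%R + l 1%R + l 2%:R%R <= n)%N /\ forall i, L (l i) (sec g i).
Proof.
elim: n g => [g [j ->]|n IH g [h [e [j [Lh ->]]]]].
  by exists (fun _ => 0%N); split=> // i; rewrite sec_xX; exists 0%N.
have [l [sl Ll]] := IH _ Lh; have eh := even_B (L_B Lh).
exists (fun i => l i + ind (b h) i)%N; split=> [|i]; last exact: L_sec_step.
by have := sum_indicator (b h); lia.
Qed.

(** The last two syllables either merge, when the power of [x] between them is trivial, or
    contribute to different sections, so that no section receives all of them. *)
Lemma L_contract n g : L n.+2 g -> L n.+1 g \/ exists l : 'Z_3 -> nat,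
  [/\ (l 0%R + l 1%R + l 2%:R%R <= n.+2)%N, (forall i, l i <= n.+1)%N & forall i, L (l i) (sec g i)].
Proof.
move=> [_ [e' [j' [[h [e [j [Lh ->]]]] ->]]]].
have [j0|jn0] := eqVneq (j%:R : 'Z_3)%R 0%R.
  left; exists h, (e + e')%N, j'; split=> //.
  by rewrite (exp3_mod j x3) j0 mulg1 expgnDr mulgA.
right; have [l [sl Ll]] := L_sec Lh; have Bh := L_B Lh.
have Bg := subM sub_B Bh (subX sub_B e B_gamma).
have Bx := subX sub_B j B_x; have Bgx := subM sub_B Bg Bx.
have bE : b (h * gam ^+ e * x ^+ j) = (b h + j%:R)%R.
  by rewrite !b_B //; [rewrite b_xX (addfX sub_B b_B _ B_gamma) b_gamma mulr0 addr0 | exact: (subX sub_B e B_gamma)].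
exists (fun i => l i + ind (b h) i + ind (b h + j%:R)%R i)%N; split=> [|i|i].
- by have := sum_indicator (b h); have := sum_indicator (b h + j%:R)%R; lia.
- have : (ind (b h) i + ind (b h + j%:R)%R i <= 1)%N.
    by move: i (b h) (j%:R)%R jn0; do 3!(apply: I3P).
  have : l i <= n by move: i sl; apply: I3P; lia.
  lia.
- by rewrite -bE; apply: L_sec_step; [exact: even_B | apply: L_sec_step => //; exact: even_B].
Qed.

Lemma rtM_app (g h : W) i : rt (g * h) i = rt h (rt g i).
Proof. by rewrite rtM permM. Qed.

(** Commuting with [x] makes the root a translation and the three sections equal. Commuting with
    [gamma] makes the root fix 0, the only letter where [gamma] has a section with trivial root. The
    common section again commutes with both. *)
Lemma centralizer_Gamma z : commute x z -> commute gam z -> z = 1.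
Proof.
move=> cx cg; apply: (@bisim (fun g h => (commute x g /\ commute gam g) /\ h = 1)) => //.
move=> {cx cg z} z h [[cx cg] ->].
have ez : even (rt z).
  have rS (i : 'Z_3) : rt z (i + 1)%R = (rt z i + 1)%R :> 'Z_3.
    by have /(congr1 (fun g => rt g i)) := cx; rewrite !rtM_app rt_x !cycE.
  have r1 := rS 0%R; have r2 : rt z 2%:R%R = _ := rS 1%R; rewrite add0r in r1.
  by apply: I3P; [rewrite add0r | rewrite r1 addrC | rewrite r2 r1; ring].
have sS (i : 'Z_3) : sec z (i + 1)%R = sec z i.
  by have /(congr1 (fun g => sec g i)) := cx; rewrite !secM rt_x cycE !sec_x mul1g mulg1.
have s1 : sec z 1%R = sec z 0%R by rewrite -(sS 0%R) add0r.
have s2 : sec z 2%:R%R = sec z 0%R by rewrite -s1 -(sS 1%R).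
have sg i : sec gam i * sec z i = sec z i * sec gam (rt z i).
  by have /(congr1 (fun g => sec g i)) := cg; rewrite !secM rt_gamma perm1.
have r1 : rt z = 1.
  apply: even_eq1 => //.
  have : rt (sec gam (rt z 0%R)) = 1.
    have /(congr1 rt) := sg 0%R; rewrite !rtM sec_gamma0 rt_gamma mul1g => e.
    by apply: (mulgI (rt (sec z 0%R))); rewrite -e mulg1.
  move: (rt z 0%R); apply: I3P => //; rewrite sec_gamma.
    by move/(congr1 (fun p : {perm 'I_3} => p 0%R)); rewrite rt_x cycE perm1; z3.
  by move/(congr1 invg); rewrite rtV invgK invg1 => /(congr1 (fun p : {perm 'I_3} => p 0%R)); rewrite rt_x cycE perm1; z3.
split=> // i; left; split=> //.
have -> : sec z i = sec z 0%R by move: i; apply: I3P.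
split; last by have := sg 0%R; rewrite sec_gamma0 r1 perm1.
by have := sg 1%R; rewrite sec_gamma1 r1 perm1 s1.
Qed.

(** An odd root would invert the root of [x] and give exponent -1. *)
Lemma N1_root h : N1 h -> exists n, rt (h * x ^+ n) = 1.
Proof.
move=> Nh; have [n [e|e]] := perm3_cases (rt h); exists n; first by rewrite rtM rtX.
have [_ _ _] := N1_mul_Gamma Nh (Gamma_xX n).
have rh : rt (h * x ^+ n) = tr12.
  by rewrite rtM rtX rt_x -[LHS]mulg1 -(tperm2 o1 o2) mulgA e mul1g.
by rewrite /b rtJ rh rt_x cyc_tr12 -rt_x -rtV -/(b _) b_xV; z3.
Qed.

Lemma gammaJ_sec g i : rt g = 1 -> sec (gam ^ g) i = sec gam i ^ sec g i.
Proof. by move=> rg; rewrite secJ1. Qed.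

(* The sections of [x ^ g] are the quotients of consecutive sections of [g], which allows to
   compare the images of the generators under different sections. *)
Lemma N1_step g (l m : 'Z_3 -> nat) : N1 g -> rt g = 1 ->
  (forall i, L (l i) (sec (gam ^ g) i)) -> (forall i, L (m i) (sec (x ^ g) i)) ->
  (exists h, [/\ N1 h, B h -> B g, L (l 0%R + 2 * m 0%R) (gam ^ h) & L (l 1%R) (x ^ h)]) /\
  (exists h, [/\ N1 h, B h -> B g, L (l 0%R + 2 * m 2%:R%R) (gam ^ h) & L (l 2%:R%R) (x ^ h)]).
Proof.
move=> N1g rg Ll Lm; have [Ng _ _ _] := N1g.
have H i : exists n, N1 (sec g i * x ^+ n) /\ (B (sec g i * x ^+ n) -> B g).
  have [k [n [Gk rk gkE]]] := reduce_Gamma i Ng rg; exists n; split.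
    by apply: N1_Delta; rewrite -gkE; exact: N1_mul_Gamma.
  by move/B_Delta; rewrite -gkE; apply: (subMr sub_B); exact: Gamma_B.
have L0 := Ll 0%R; rewrite gammaJ_sec // sec_gamma0 in L0.
split.
  have [n [N1h Bh]] := H 1%R; exists (sec g 1%R * x ^+ n); split=> //.
    rewrite conjgM; apply: LJx.
    have -> : sec g 1%R = sec g 0%R * sec (x ^ g) 0%R by rewrite sec_xJ // add0r mulVKg.
    by rewrite conjgM; exact: LJ.
  rewrite conjgM; apply: LJx.
  by have := Ll 1%R; rewrite gammaJ_sec // sec_gamma1.
have [n [N1h Bh]] := H 2%:R%R; exists (sec g 2%:R%R * x ^+ n); split=> //.
  rewrite conjgM; apply: LJx.
  have -> : sec g 2%:R%R = sec g 0%R * (sec (x ^ g) 2%:R%R)^-1.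
    rewrite sec_xJ // (_ : 2%:R + 1 = 0)%R; last by z3.
    by rewrite invgM invgK mulVKg.
  by rewrite conjgM; apply: LJ => //; exact: LV.
rewrite conjgM; apply: LJx.
by have := LV (Ll 2%:R%R); rewrite gammaJ_sec // sec_gamma2 conjVg invgK.
Qed.

(** Here the exponents force x^h = x and gamma^h = gamma^(x^j), so that h x^-j centralizes Gamma. *)
Lemma N1_base h : N1 h -> L 1 (gam ^ h) -> L 0 (x ^ h) -> B h.
Proof.
move=> [Nh ag ax bx] [_ [e [j [[i ->] eg]]]] [k ek].
have xh : x ^ h = x.
  by move: bx; rewrite ek b_xX => k1; rewrite (exp3_mod k x3) k1.
have gE : gam ^ h = gam ^ (x ^+ j).
  have [Bx Bg Bx'] := And3 (subX sub_B i B_x) (subX sub_B e B_gamma) (subX sub_B j B_x).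
  have Bxg := subM sub_B Bx Bg.
  have := b_J_gamma h; rewrite eg b_B // b_B // !b_xX (addfX sub_B b_B) ?b_gamma; last exact: B_gamma.
  rewrite mulr0 addr0 => ij.
  move: ag; rewrite eg a_B // a_B // !(addfX sub_B a_B) ?a_gamma ?a_x; try solve [exact: B_x | exact: B_gamma].
  rewrite !mulr0 addr0 add0r mulr1 => e1.
  rewrite (exp3_mod e gamma3) e1 /conjg mulgA; congr (_ * _ * _).
  apply: (mulIg (x ^+ j)); rewrite mulVg -expgnDr (exp3_mod _ x3) natrD ij.
  done.
suff hz : h * x ^- j = 1.
  by rewrite -[h](mulgVK (x ^+ j)) hz mul1g; apply: (subX sub_B); exact: B_x.
apply: centralizer_Gamma; apply/commgP; rewrite -conjg_fix; apply/eqP.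
  rewrite conjgM xh; apply/conjg_fixP/eqP; apply/eqP/commgP.
  by apply: commuteV; exact: commuteX.
by rewrite conjgM gE conjgK.
Qed.

(* For lengths G of [gamma ^ h] and X of [x ^ h], one of the two sections provided by [N1_step] has
   G' + 2 X' <= G + X; when X = 0, [L_contract] excludes that G stays constant. *)
Lemma N1_B_length N : forall h G X, N1 h -> L G (gam ^ h) -> L X (x ^ h) ->
  (2 * (G + 2 * X) + (X == 0) < N)%N -> B h.
Proof.
elim: N => // N IH h G X N1h LG LX; rewrite ltnS => HN.
have [n rg] := N1_root N1h; set g := h * x ^+ n.
have N1g : N1 g by apply: N1_mul_Gamma => //; exact: Gamma_xX.
have Bgh : B g -> B h by apply: (subMr sub_B); apply: Gamma_B; exact: Gamma_xX.
have LGg : L G (gam ^ g) by rewrite conjgM; exact: LJx.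
have LXg : L X (x ^ g) by rewrite conjgM; exact: LJx.
have [m [sm Lm]] := L_sec LXg.
have [X0|Xpos] := posnP X; last first.
  have [l [sl Ll]] := L_sec LGg.
  have [[h1 [N1h1 Bh1 Lg1 Lx1]] [h2 [N1h2 Bh2 Lg2 Lx2]]] := N1_step N1g rg Ll Lm.
  apply: Bgh; have [le12|lt21] := leqP (m 0%R + l 1%R) (m 2%:R%R + l 2%:R%R).
    by apply: Bh1; apply: (IH h1 _ _ N1h1 Lg1 Lx1); move: HN; case: eqP; case: eqP; lia.
  by apply: Bh2; apply: (IH h2 _ _ N1h2 Lg2 Lx2); move: HN; case: eqP; case: eqP; lia.
subst X; case: G LG HN LGg => [|[|G]] LG HN LGg.
- by apply: N1_base N1h _ LX; exact: L_S.
- exact: N1_base N1h LG LX.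
have [LG'|[l [sl ml Ll]]] := L_contract LGg.
  by apply: Bgh; apply: (IH g _ _ N1g LG' LXg); move: HN; lia.
have [[h1 [N1h1 Bh1 Lg1 Lx1]] [h2 [N1h2 Bh2 Lg2 Lx2]]] := N1_step N1g rg Ll Lm.
(* All [m i] are 0 here. If the new x-length is positive, the summand [(X == 0)] of the measure is
   lost; if it is 0, the new gamma-length is [l 0], which [L_contract] bounds strictly. *)
have ml0 := ml 0%R; apply: Bgh; have [le12|lt21] := leqP (l 1%R) (l 2%:R%R).
  by apply: Bh1; apply: (IH h1 _ _ N1h1 Lg1 Lx1); move: HN; case: eqP; lia.
by apply: Bh2; apply: (IH h2 _ _ N1h2 Lg2 Lx2); move: HN; case: eqP; lia.
Qed.

Lemma N1_B h : N1 h -> B h.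
Proof.
move=> N1h; have [Nh _ _ _] := N1h.
have [G LG] := Gamma_L (normalizerJ Nh Gamma_gamma).
have [X LX] := Gamma_L (normalizerJ Nh Gamma_x).
exact: N1_B_length N1h LG LX (ltnSn _).
Qed.

Lemma root_reduction g : exists (s : W) n, [/\ s = 1 \/ s = ta 1 & rt (g * x ^+ n * s) = 1].
Proof.
have [n [e|e]] := perm3_cases (rt g).
  by exists 1, n; split; [left | rewrite mulg1 rtM rtX].
by exists (ta 1), n; split; [right | rewrite 2!rtM rtX].
Qed.

Lemma B_normalizer_Gamma g : B g -> normalizer Gamma g.
Proof.
move=> /B_decomp[k [w [Gk Uw ->]]]; apply: (subM (sub_normalizer Gamma)).
  exact: normalizer_sub sub_Gamma Gk.
by apply: Uh_normalizer; exact: Uh_Delta.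
Qed.

Lemma A_normalizer_Gamma g : A g -> normalizer Gamma g.
Proof.
move=> [h [v [Bh [Vv ->]]]]; apply: (subM (sub_normalizer Gamma)); first exact: B_normalizer_Gamma.
exact: V_Gamma.
Qed.

Lemma a_tau3 y : Gamma y -> a (y ^ ta 3) = (- a y)%R.
Proof.
move=> Gy; rewrite (@additive_Gamma (fun z => a (z ^ ta 3)) y) //.
  by rewrite gamma_tau3 x_tau3 (addfV sub_B a_B B_gamma) a_gamma a_xV mulr0 addr0 mulrN1.
move=> h k Gh Gk; rewrite conjMg a_B //; apply: Gamma_B; exact: normalizerJ (V_Gamma V_tau3) _.
Qed.
Lemma b_tau3 y : Gamma y -> b (y ^ ta 3) = (- b y)%R.
Proof.
move=> Gy; rewrite (@additive_Gamma (fun z => b (z ^ ta 3)) y) //.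
  by rewrite gamma_tau3 x_tau3 (addfV sub_B b_B B_gamma) b_gamma b_xV oppr0 mulr0 add0r mulrN1.
move=> h k Gh Gk; rewrite conjMg b_B //; apply: Gamma_B; exact: normalizerJ (V_Gamma V_tau3) _.
Qed.

(** Otherwise x^h, and hence x, would fix the first level. *)
Lemma b_xJ_neq0 h : normalizer Gamma h -> b (x ^ h) <> 0%R.
Proof.
move=> Nh b0; have Gx := normalizerJ Nh Gamma_x.
have rx : rt (x ^ h) = 1 by apply: even_eq1 b0; apply: even_B; exact: Gamma_B.
have : rt x = 1 by rewrite -[x](conjgK h) rtJ rx conj1g.
by move/(congr1 (fun p : {perm 'I_3} => p 0%R)); rewrite rt_x cycE perm1; z3.
Qed.

Lemma normalizer_tau3 h : normalizer Gamma h ->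
  [/\ a (x ^ h) = 0%R, b (x ^ h) = a (gam ^ h) & b (x ^ h) <> 1%R] -> N1 (h * ta 3).
Proof.
move=> Nh [ax bE b1].
have Gx := normalizerJ Nh Gamma_x; have Gg := normalizerJ Nh Gamma_gamma.
have bx : b (x ^ h) = (-1)%R by have := b_xJ_neq0 Nh; move: (b _) b1; apply: I3P => [_ /(_ erefl)|/(_ erefl)|_ _] //; z3.
split.
- by apply: (subM (sub_normalizer Gamma)) => //; exact: V_Gamma V_tau3.
- by rewrite conjgM a_tau3 // -bE bx opprK.
- by rewrite conjgM a_tau3 // ax oppr0.
- by rewrite conjgM b_tau3 // bx opprK.
Qed.

(** The common value of the two exponents is 1 or -1, and [tau 3] inverts both generators, so [h] or
    [h * tau 3] acts trivially on the abelianization. *)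
Lemma normalizer_Gamma_cases h : normalizer Gamma h -> a (x ^ h) = 0%R -> b (x ^ h) = a (gam ^ h) ->
  exists2 c, B c & h = c \/ h = c * ta 3.
Proof.
move=> Nh ax bE; have [b1|/eqP nb1] := eqVneq (b (x ^ h)) 1%R.
  by exists h; [apply: N1_B; split; rewrite -?bE | left].
exists (h * ta 3); first by apply: N1_B; exact: normalizer_tau3.
by right; rewrite -mulgA tauE mulg1.
Qed.

Lemma A_Delta_cases h c : B c -> h = c \/ h = c * ta 3 -> A (Delta h).
Proof.
move=> Bc [->|->]; first by apply: B_A; exact: B_Delta.
by exists (Delta c), (ta 2); split; [exact: B_Delta | split; [exact: V_tau2 | rewrite DeltaM -tau2E]].
Qed.

Lemma normalizer_Gamma g : normalizer Gamma g <-> A g.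
Proof.
split; last exact: A_normalizer_Gamma.
move=> Ng; have [s [n [Vs rg]]] := root_reduction g.
have {}Vs : V s by case: Vs => ->; [exact: V1 | exact: V_tau1].
have sN := sub_normalizer Gamma.
have Ag' := subM sub_A (V_A Vs) (B_A (Gamma_B (Gamma_xX n))).
have Ng' : normalizer Gamma (g * x ^+ n * s).
  apply: (subM sN); last exact: V_Gamma.
  by apply: (subM sN) => //; apply: normalizer_sub sub_Gamma _; exact: Gamma_xX.
apply: (subMr sub_A) (B_A (Gamma_B (Gamma_xX n))) _; apply: (subMr sub_A) (V_A Vs) _.
have [k [m [Gk rk gkE]]] := reduce_Gamma 0%R Ng' rg.
apply: (subMr sub_A) (B_A (Gamma_B Gk)) _; rewrite gkE.
have ND : normalizer Gamma (Delta (sec (g * x ^+ n * s) 0%R * x ^+ m)).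
  by rewrite -gkE; apply: (subM sN) => //; exact: normalizer_sub sub_Gamma Gk.
have [ax bE] := Delta_normalizer_exponents ND.
have [c Bc hE] := normalizer_Gamma_cases (Delta_normalizer_sections ND) ax bE.
exact: A_Delta_cases hE.
Qed.

(** * The second normalizer *)

Lemma B_proj (i : 'Z_3) g : B g -> exists s, [/\ B s, rt s = 1 & sec s i = g].
Proof.
move=> /B_decomp[k [w [Gk Uw ->]]]; have [s [Gs s1 <-]] := Gamma_proj i Gk.
exists (s * Delta (Delta w)); split.
- apply: (subM sub_B); first exact: Gamma_B.
  by apply: Uh_B; do 2!apply: Uh_Delta.
- by rewrite rtM s1 mulg1.
- by rewrite secM s1 perm1 sec_Delta.
Qed.

Lemma proj_B g i : normalizer B g -> rt g = 1 -> normalizer B (sec g i).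
Proof. by move=> Ng rg; apply: proj_normalizer Ng rg _ (@B_proj i) => s; exact: B_sec. Qed.

Lemma Delta_normalizer_B h : normalizer B (Delta h) -> normalizer B h.
Proof. by move=> N; rewrite -(sec_Delta h 0%R); exact: proj_B. Qed.

Lemma Partial_sec_eq g h : rt h = 1 -> sec h 0%R = 1 -> sec h 1%R = g -> sec h 2%:R%R = g^-1 ->
  h = Partial g.
Proof.
by move=> r0 s0 s1 s2; apply: Wext => //; apply: I3P; rewrite sec_Partial.
Qed.

Lemma Partial_tau1 g : Partial g ^ ta 1 = Partial (g^-1 ^ ta 1).
Proof.
apply: Partial_sec_eq; first by rewrite rtJ1.
- by rewrite secJ_tau1 oppE sec_Partial conj1g.
- by rewrite secJ_tau1 oppE sec_Partial.
- by rewrite secJ_tau1 oppE sec_Partial conjVg invgK.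
Qed.

Lemma Partial_tau2 g : Partial g ^ ta 2 = Partial (g ^ ta 3).
Proof.
apply: Partial_sec_eq; first by rewrite rtJ1.
- by rewrite secJ_tau2 sec_Partial conj1g.
- by rewrite secJ_tau2 sec_Partial.
- by rewrite secJ_tau2 sec_Partial conjVg.
Qed.

Lemma Partial_tau3 g : Partial g ^ ta 3 = Partial (g^-1 ^ ta 2).
Proof.
apply: Partial_sec_eq; first by rewrite rtJ1.
- by rewrite secJ_tau3 oppE sec_Partial conj1g.
- by rewrite secJ_tau3 oppE sec_Partial.
- by rewrite secJ_tau3 oppE sec_Partial conjVg invgK.
Qed.

Lemma Partial1 : Partial 1 = 1.
Proof. by apply/esym; apply: Partial_sec_eq; rewrite ?sec1 ?invg1. Qed.

Lemma PartialM w v : commute w v -> Partial w * Partial v = Partial (w * v).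
Proof.
move=> cwv; apply: Partial_sec_eq; first by rewrite rtM mulg1.
- by rewrite secM rt_Partial perm1 !sec_Partial mulg1.
- by rewrite secM rt_Partial perm1 !sec_Partial.
- by rewrite secM rt_Partial perm1 !sec_Partial cwv invgM.
Qed.

Lemma PartialV w : (Partial w)^-1 = Partial w^-1.
Proof.
by apply: Partial_sec_eq; rewrite ?rtV ?secV ?rt_Partial ?invg1 // perm1 sec_Partial ?invg1.
Qed.

Lemma Partial_UhM w v : Uh w -> Uh v -> Partial w * Partial v = Partial (w * v).
Proof. by move=> Uw Uv; apply: PartialM; exact: Uh_commute. Qed.

Lemma Partial_UhC w v : Uh w -> Uh v -> commute (Partial w) (Partial v).
Proof. by move=> Uw Uv; rewrite /commute !Partial_UhM // (Uh_commute Uw Uv). Qed.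

Lemma Partial_exp3 w : Uh w -> Partial w ^+ 3 = 1.
Proof.
move=> Uw; rewrite !expgS mulg1 !Partial_UhM //; last exact: UhM.
by rewrite -Partial1 -(Uh_exp3 Uw) !expgS mulg1.
Qed.

(** The cyclic quotients of the sections 1, w, w^-1 are all equal to w, because w^3 = 1. *)
Lemma x_Partial w : Uh w -> x ^ Partial w = x * Delta w.
Proof.
move=> Uw; have w2 : w^-1 * w^-1 = w by rewrite (exp3V (Uh_exp3 Uw)) -expgnDr expgS (Uh_exp3 Uw) mulg1.
apply: Wext => [|i]; first by rewrite rtJ rt_Partial conjg1 rtM rt_Delta mulg1.
rewrite sec_xJ // secM sec_x mul1g sec_Delta.
have e1 : (0 + 1)%R = 1%R :> 'Z_3 by z3.
have e2 : (1 + 1)%R = 2%:R%R :> 'Z_3 by z3.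
have e3 : (2%:R + 1)%R = 0%R :> 'Z_3 by z3.
by move: i; apply: I3P; rewrite (e1, e2, e3) !sec_Partial ?invg1 ?mul1g ?mulg1 ?invgK.
Qed.

Lemma gamma_Partial w : Uh w -> gam ^ Partial w = gam.
Proof.
move=> Uw; apply: Wext => [|i]; first by rewrite rtJ1.
have xw : x ^ w = x by have := UhJ (Uh_x 1) Uw; rewrite expg1.
have xVw : x ^ w^-1 = x by rewrite -{1}xw conjgK.
by rewrite secJ1 //; move: i; apply: I3P; rewrite sec_gamma sec_Partial ?conjg1 ?conjVg ?xVw ?xw.
Qed.

Lemma Delta_Partial u w : Uh u -> Uh w -> Delta u ^ Partial w = Delta u.
Proof.
move=> Uu Uw; apply: Wext => [|i]; first by rewrite rtJ1.
rewrite secJ1 // sec_Delta; move: i; apply: I3P; rewrite sec_Partial ?conjg1 //.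
  exact: UhJ.
by apply: UhJ => //; exact: UhV.
Qed.

Lemma Partial_normalizer_B w : Uh w -> normalizer B (Partial w).
Proof.
suff H v : Uh v -> forall s, s = gam \/ (exists n, s = xn n) -> B (s ^ Partial v).
  by move=> Uw; apply: gen_J_normalizer; rewrite ?PartialV; apply: H => //; exact: UhV.
move=> Uv s [->|[[|n] ->]]; first by rewrite gamma_Partial //; exact: B_gamma.
  by rewrite x_Partial //; apply: (subM sub_B); [exact: B_x | apply: Uh_B; exact: Uh_Delta].
by rewrite xnS Delta_Partial; [exact: (B_xn n.+1) | exact: Uh_xn |].
Qed.

Lemma Partial_tau1_fix w : Uh w -> Partial w ^ ta 1 = Partial w.
Proof. by move=> Uw; rewrite Partial_tau1 Uh_tau1 ?invgK //; exact: UhV. Qed.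

Lemma sec_mulr_xJ g k h (w : 'Z_3 -> W) : rt g = 1 -> rt k = 1 ->
  (forall j, sec (g * k) j = h * w j) -> forall j, sec (x ^ (g * k)) j = (w j)^-1 * w (j + 1)%R.
Proof.
move=> rg rk sE j; rewrite sec_xJ; last by rewrite rtM rg rk mulg1.
by rewrite !sE invgM -mulgA mulKg.
Qed.

Lemma Uh_eq w v : Uh w -> Uh v -> (forall n, beta n w = beta n v) -> w = v.
Proof.
move=> Uw Uv e; have UvV := UhV Uv.
apply: divg1_eq; apply: Uh_eq1 => [|n]; first exact: UhM.
by rewrite beta_B ?(addfV sub_B (@beta_B n)) ?e ?subrr //; exact: Uh_B.
Qed.

(** On [B] the exponents of sections obey constancy only, so the quotients w_j^-1 w_(j+1) are equal
    rather than trivial; hence the sections are 1, w, w^2 = w^-1 up to the common factor. *)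
Lemma reduce_B g : normalizer B g -> rt g = 1 ->
  exists k h w, [/\ Gamma k, Uh w & g * k = Delta h * Partial w].
Proof.
move=> Ng rg; have Bx := normalizerJ Ng B_x.
have Bd j : B ((sec g j)^-1 * sec g (j + 1)%R) by rewrite -sec_xJ //; exact: B_sec.
have [k [n [w [Gk rk Uw w0 sgk]]]] := reduce_sections rg (B_diff Bd 0%R).
exists k, (sec g 0%R * x ^+ n), (w 1%R); split=> //.
have Ngk : normalizer B (g * k).
  by apply: (subM (sub_normalizer B)) => //; apply: normalizer_sub sub_B _; exact: Gamma_B.
pose y j := (w j)^-1 * w (j + 1)%R.
have Uy j : Uh (y j) by apply: UhM => //; exact: UhV.
have xgk := normalizerJ Ngk B_x.
have sy j : sec (x ^ (g * k)) j = y j by exact: sec_mulr_xJ rg rk sgk j.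
have yE j : y j = y 0%R.
  apply: Uh_eq => // -[|m]; last by rewrite -!sy !beta_sec.
  by have := kappa_const j xgk; rewrite !kappaE !sy !(Uh_a (Uy _)) !subr0 !addr0.
have y0 : y 0%R = w 1%R by rewrite /y w0 invg1 mul1g add0r.
have w2 : w 2%:R%R = (w 1%R)^-1.
  have := yE 1%R; rewrite y0 => e; rewrite (exp3V (Uh_exp3 (Uw _))) expg2 -{2}e /y mulVKg.
  by congr w; z3.
have rgk : rt (g * k) = 1 by rewrite rtM rg rk mulg1.
apply: Wext => [|j]; first by rewrite rgk rtM mulg1.
rewrite sgk secM rt_Delta perm1 sec_Delta.
by congr (_ * _); move: j; apply: I3P; rewrite sec_Partial.
Qed.

Lemma normalizer_B_decomp g : normalizer B g -> exists n (s : W) k h w,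
  [/\ s = 1 \/ s = ta 1, Gamma k, Uh w, normalizer B (Delta h) &
      g = Delta h * Partial w * (k * s * x ^+ n)].
Proof.
move=> Ng; have [s [n [s1 rg]]] := root_reduction g.
have Vs : V s by case: s1 => ->; [exact: V1 | exact: V_tau1].
have sN := sub_normalizer B.
have Nx m : normalizer B (x ^+ m) by apply: normalizer_sub sub_B _; apply: Gamma_B; exact: Gamma_xX.
have Ng' : normalizer B (g * x ^+ n * s).
  by apply: (subM sN); [exact: (subM sN) | exact: V_B].
have [k [h [w [Gk Uw e]]]] := reduce_B Ng' rg.
have Nk : normalizer B k by apply: normalizer_sub sub_B _; exact: Gamma_B.
exists (2 * n)%N, s, k^-1, h, w; split=> //.
- exact: (subV sub_Gamma).
- apply: (subMr sN) (Partial_normalizer_B Uw) _; rewrite -e; exact: (subM sN).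
- have sV : s^-1 = s by exact: V_inv.
  by rewrite -e expgnA -x_inv expVgn -{2}sV; gnorm.
Qed.

Lemma A_conj_exponent y z : Uh y -> A z -> a (y ^ z) = 0%R.
Proof.
move=> Uy [c [v [Bc [Vv ->]]]]; rewrite wmulE conjgM conjJg.
have Uyv := Uh_V Uy Vv.
by rewrite (addfJ sub_B a_B) ?Uh_a //; [exact: Uh_B | exact: normalizerJ (V_B Vv) Bc].
Qed.

Lemma A_word k s n : Gamma k -> V s -> A (k * s * x ^+ n).
Proof.
move=> Gk Vs; apply: (subM sub_A).
  by apply: (subM sub_A); [apply: B_A; exact: Gamma_B | exact: V_A].
by apply: B_A; apply: Gamma_B; exact: Gamma_xX.
Qed.

Lemma V_1_tau1 (s : W) : s = 1 \/ s = ta 1 -> V s.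
Proof. by case=> ->; [exact: V1 | exact: V_tau1]. Qed.

Lemma x_Delta g : x ^ Delta g = x.
Proof. by apply/conjg_fixP/eqP; apply/eqP/commgP; exact: commute_x_Delta. Qed.

(** By the decomposition, x^h is the conjugate of x Delta(w) by an element of [A], which creates no
    gamma-exponent. *)
Lemma a_xJ h : normalizer B h -> a (x ^ h) = 0%R.
Proof.
move=> /normalizer_B_decomp[n [s [k [h' [w [s1 Gk Uw _ ->]]]]]].
rewrite conjgM [x ^ (_ * _)]conjgM x_Delta x_Partial //; apply: A_conj_exponent.
  by have := UhS 1 Uw; rewrite expg1.
by apply: A_word => //; exact: V_1_tau1.
Qed.

(** Each [beta n.+1] agrees on the sections gamma^h, x^h and (x^h)^-1 of gamma^(Delta h). The last
    two values are opposite, so all are 0 and [B_Gamma] applies. *)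
Lemma Delta_normalizer_B_exponents h : normalizer B (Delta h) ->
  [/\ Gamma (gam ^ h), Gamma (x ^ h) & b (x ^ h) = a (gam ^ h)].
Proof.
move=> N; have Nh := Delta_normalizer_B N.
have Bx := normalizerJ Nh B_x; have Bg := normalizerJ Nh B_gamma.
have BD := normalizerJ N B_gamma.
have ax := a_xJ Nh.
have bE n : beta n.+1 (gam ^ h) = 0%R /\ beta n.+1 (x ^ h) = 0%R.
  have := beta_sec n 0%R BD; have := beta_sec n 1%R BD; have := beta_sec n 2%:R%R BD.
  rewrite !sec_gammaJ_Delta !sec_gamma conjVg (addfV sub_B (@beta_B n.+1)) // => <-.
  by move: (beta _ _) (beta _ _) => p q *; split; z3.
split; try by apply: B_Gamma => // n; case: (bE n).
have := kappa_const 1%R BD; rewrite !kappaE add0r.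
have -> : (1 + 1)%R = 2%:R%R :> 'Z_3 by z3.
have -> : (1 + 2%:R)%R = 0%R :> 'Z_3 by z3.
rewrite add0r !sec_gammaJ_Delta !sec_gamma conjVg (addfV sub_B a_B) // ax b_J_gamma.
by move: (b _) (a _); z3.
Qed.

Lemma Delta_normalizer_B_A h : normalizer B (Delta h) -> A (Delta h).
Proof.
move=> N; have [Gg Gx bE] := Delta_normalizer_B_exponents N.
have NV : normalizer B (Delta h^-1) by rewrite DeltaV; exact: (subV (sub_normalizer B)).
have [GgV GxV _] := Delta_normalizer_B_exponents NV.
have Nh : normalizer Gamma h by apply: gen_J_normalizer => s [->|->].
have ax := a_xJ (Delta_normalizer_B N).
have [c Bc hE] := normalizer_Gamma_cases Nh ax bE; exact: A_Delta_cases Bc hE.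
Qed.

(** [Partial w] can be moved to the right end because it normalizes [B] and commutes with
    [tau 1]. *)
Lemma normalizer_B g : normalizer B g -> exists al w, [/\ A al, Uh w & g = al * Partial w].
Proof.
move=> /normalizer_B_decomp[n [s [k [h [w [s1 Gk Uw N ->]]]]]].
exists (Delta h * (k * s * x ^+ n) ^ (Partial w)^-1), w; split=> //; last first.
  by rewrite [_ ^ (Partial w)^-1]/conjg invgK; gnorm.
apply: (subM sub_A); first exact: Delta_normalizer_B_A.
have NB := Partial_normalizer_B Uw.
have -> : (k * s * x ^+ n) ^ (Partial w)^-1 = k ^ (Partial w)^-1 * s * (x ^+ n) ^ (Partial w)^-1.
  rewrite !conjMg; congr (_ * _ * _); case: s1 => ->; first by rewrite conj1g.
  have e := Partial_tau1_fix Uw; apply/conjg_fixP/eqP; apply/eqP/commgP; apply: commuteV; apply: commute_sym.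
  by apply/commgP; rewrite -conjg_fix; apply/eqP.
apply: (subM sub_A); [apply: (subM sub_A)|]; [apply: B_A | exact: V_A (V_1_tau1 s1) | apply: B_A].
  exact: normalizerJV NB (Gamma_B Gk).
exact: normalizerJV NB (Gamma_B (Gamma_xX n)).
Qed.

(* Elements of order 3 are squares, which makes such subgroups characteristic in extensions by [V]. *)
Definition gen3 (H : wset) := forall K, is_subgroup K -> (forall h, H h -> h ^+ 3 = 1 -> K h) ->
  forall h, H h -> K h.

Lemma normalizer_gen3 (H C : wset) g : is_subgroup H -> gen3 H -> (forall h, H h -> C h) ->
  (forall c, C c -> H (c * c)) -> normalizer C g -> normalizer H g.
Proof.
move=> sH g3H HC CH.
have half g' : normalizer C g' -> forall h, H h -> H (h ^ g').
  move=> N; apply: g3H => [|h Hh h3].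
    split; [|split].
    - by rewrite conj1g; exact: (sub1 sH).
    - by move=> h k Hh Hk; rewrite wmulE conjMg; exact: (subM sH).
    - by move=> h Hh; rewrite winvE conjVg; exact: (subV sH).
  have -> : h = h^-1 * h^-1 by rewrite (exp3V h3) -expgnDr expgS h3 mulg1.
  rewrite conjMg; apply: CH; apply: (normalizerJ N); apply: HC; exact: (subV sH).
by move=> N; apply: normalizer_intro; apply: half => //; exact: (subV (sub_normalizer C)).
Qed.

Lemma setmul_V_square H : is_subgroup H -> (forall v, V v -> normalizer H v) ->
  forall c, setmul H V c -> H (c * c).
Proof.
move=> sH N _ [h [v [Hh [Vv ->]]]]; rewrite wmulE.
rewrite (_ : _ * _ = h * h ^ v^-1 * (v * v)); last by gnorm.
have -> : v * v = 1 by rewrite -{1}(V_inv Vv) mulVg.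
by rewrite mulg1; apply: (subM sH) => //; exact: normalizerJV (N _ Vv) Hh.
Qed.

Lemma gen3_B : gen3 B.
Proof.
move=> K sK HK; apply: gen_ind => [|s [->|[n ->]]|g h _ _|g _].
- exact: (sub1 sK).
- by apply: HK; [exact: B_gamma | exact: gamma3].
- by apply: HK; [exact: B_xn | apply: Uh_exp3; exact: Uh_xn].
- exact: (subM sK).
- exact: (subV sK).
Qed.

Lemma normalizer_A_B g : normalizer A g -> normalizer B g.
Proof.
apply: normalizer_gen3; [exact: sub_B | exact: gen3_B | exact: B_A |].
exact: setmul_V_square sub_B V_B.
Qed.

Lemma even_mul_tr12 p : even p -> ~ even (p * tr12).
Proof. by move=> ep /(evenM (evenV ep)); rewrite mulKg; exact: even_tr12. Qed.

(** A nontrivial factor in [V] shows in the first two levels: [tau 1] and [tau 3] have odd root,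
    [tau 2] has sections with odd root. *)
Lemma setmul_V_even H z : (forall h, H h -> even (rt h) /\ even (rt (sec h 0%R))) ->
  setmul H V z -> rt z = 1 -> even (rt (sec z 0%R)) -> H z.
Proof.
move=> He [h [v [Hh [Vv ->]]]] rz; have [e0 e1] := He _ Hh.
have ez : even (rt (h * v)) by rewrite wmulE in rz; rewrite rz; exact: even1.
move: ez; rewrite wmulE; case: Vv => [->|[->|[->|->]]]; first by rewrite mulg1.
- by rewrite rtM rt_tau => /(even_mul_tr12 e0).
- by move=> _; rewrite secM sec_tau rtM rt_tau => /(even_mul_tr12 e1).
- by rewrite rtM rt_tau => /(even_mul_tr12 e0).
Qed.

Lemma A_even_B z : A z -> rt z = 1 -> even (rt (sec z 0%R)) -> B z.
Proof.
apply: setmul_V_even => h Bh; split; apply: even_B => //; exact: B_sec.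
Qed.

Lemma Partial_B_eq1 y : Uh y -> B (Partial y) -> y = 1.
Proof.
move=> Uy BP; apply: Uh_eq1 => // -[|n].
  have := kappa_const 1%R BP; rewrite !kappaE add0r.
  have -> : (1 + 1)%R = 2%:R%R :> 'Z_3 by z3.
  have -> : (1 + 2%:R)%R = 0%R :> 'Z_3 by z3.
  by rewrite !sec_Partial !(Uh_a (UhV Uy)) !(Uh_a Uy) (Uh_a Uh1) b1 !subr0 !addr0.
have := beta_sec n 1%R BP; have := beta_sec n 0%R BP; rewrite !sec_Partial beta1.
by move=> <-.
Qed.

(** * T as the image under Partial of the odd part of Uh *)

Definition Uo (w : W) := Uh w /\ forall n, ~~ odd n -> beta n w = 0%R.

Lemma beta_xn m n : beta m (xn n) = (m == n)%:R%R.
Proof.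
elim: n m => [|n IH] [|m] //; first exact: b_x.
- by rewrite betaS_x.
- by rewrite xnS beta0_Delta.
- by rewrite xnS beta_Delta IH.
Qed.

Lemma Uo_xn k : Uo (xn (2 * k + 1)).
Proof.
split=> [|n en]; first exact: Uh_xn.
rewrite beta_xn; case: eqP => // e; move: en; rewrite e; lia.
Qed.

Lemma sub_Uo : is_subgroup Uo.
Proof.
split; [|split].
- by split=> [|n _]; [exact: Uh1 | exact: beta1].
- move=> w v [Uw ew] [Uv ev]; split=> [|n en]; first exact: UhM.
  by rewrite wmulE beta_B ?ew ?ev ?addr0 //; exact: Uh_B.
- move=> w [Uw ew]; split=> [|n en]; first exact: UhV.
  by rewrite winvE (addfV sub_B (@beta_B n)) ?ew ?oppr0 //; exact: Uh_B.
Qed.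

Lemma sub_T : is_subgroup T. Proof. exact: sub_gen. Qed.

(** Peeling off one level exchanges the parities, so both are treated together; [k] records the
    levels already removed. *)
Lemma T_Partial_odd w : Uh w -> forall k,
  ((forall n, ~~ odd n -> beta n w = 0%R) -> T (Partial (DeltaN (2 * k) w))) /\
  ((forall n, odd n -> beta n w = 0%R) -> T (Partial (DeltaN (2 * k + 1) w))).
Proof.
have D1 n : DeltaN n 1 = 1 by elim: n => // n IH; rewrite /DeltaN iterS -/(DeltaN n 1) IH Delta1.
elim=> [k|n {}w Uw IH k].
  by rewrite !D1 !Partial1; split=> _; exact: (sub1 sub_T).
have DS m v : DeltaN m (Delta v) = DeltaN m.+1 v by rewrite /DeltaN iterSr.
have DM m v u : DeltaN m (v * u) = DeltaN m v * DeltaN m u.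
  by elim: m => // m IHm; rewrite /DeltaN !iterS -!/(DeltaN m _) IHm DeltaM.
have UD m v : Uh v -> Uh (DeltaN m v).
  by elim: m => // m IHm Uv; rewrite /DeltaN iterS; apply: Uh_Delta; exact: IHm.
split=> e0.
  have := e0 0%N isT; rewrite beta_UhS // => n0.
  rewrite (exp3_mod n x3) n0 mul1g DS -addn1.
  apply: (IH k).2 => m om; have := e0 m.+1; rewrite beta_UhS //=; rewrite om; exact.
rewrite DM -Partial_UhM; try exact: UD (Uh_x _); try exact: UD (Uh_Delta Uw).
apply: (subM sub_T).
  have -> : DeltaN (2 * k + 1) (x ^+ n) = xn (2 * k + 1) ^+ n.
    by elim: n {e0} => // n IHn; rewrite !expgS DM IHn.
  have Tx : T (Partial (xn (2 * k + 1))) by apply: mem_gen; exists k.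
  have -> : Partial (xn (2 * k + 1) ^+ n) = Partial (xn (2 * k + 1)) ^+ n.
    elim: n {e0} => [|n IHn]; first exact: Partial1.
    by rewrite !expgS -Partial_UhM ?IHn //; [exact: Uh_xn | apply: UhX; exact: Uh_xn].
  exact: (subX sub_T).
rewrite DS (_ : (2 * k + 1).+1 = 2 * k.+1)%N; last by lia.
apply: (IH k.+1).1 => m om; have := e0 m.+1; rewrite beta_UhS //=; exact.
Qed.

Lemma T_Partial g : T g <-> exists2 w, Uo w & g = Partial w.
Proof.
split=> [Tg|[w [Uw ew] ->]]; last by have [H _] := T_Partial_odd Uw 0; exact: H.
apply: (Tg (fun g => exists2 w, Uo w & g = Partial w)).
  split; [|split].
  - by exists 1; [exact: (sub1 sub_Uo) | rewrite Partial1].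
  - move=> _ _ [w Ow ->] [v Ov ->]; exists (w * v); first exact: (subM sub_Uo).
    by rewrite wmulE Partial_UhM //; [case: Ow | case: Ov].
  - by move=> _ [w Ow ->]; exists w^-1; [exact: (subV sub_Uo) | rewrite winvE PartialV].
by move=> _ [n ->]; exists (xn (2 * n + 1)); [exact: Uo_xn | ].
Qed.

Lemma Uo_tau3 w : Uo w -> w ^ ta 3 = w.
Proof.
move=> [Uw ew]; have [_ U3] := Uh_tau23 Uw; apply: Uh_eq => // n.
by have [_ ->] := beta_tau23 n Uw; case: ifP => // /negbT /ew ->; rewrite oppr0.
Qed.

Lemma Partial_tau2_fix w : Uo w -> Partial w ^ ta 2 = Partial w.
Proof. by move=> Ow; rewrite Partial_tau2 Uo_tau3. Qed.

Lemma T_V g v : T g -> V v -> g ^ v = g.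
Proof.
move=> /T_Partial[w Ow ->]; have [Uw _] := Ow.
have [e1 e2] := (Partial_tau1_fix Uw, Partial_tau2_fix Ow).
by move=> [->|[->|[->|->]]]; rewrite -?tau12 ?conjg1 ?conjgM ?e1 ?e2.
Qed.

Lemma conj_commute (g h : W) : g ^ h = g -> commute g h.
Proof. by move=> e; apply/commgP; rewrite -conjg_fix; apply/eqP. Qed.

Lemma T_normalizer_B g : T g -> normalizer B g.
Proof. by move=> /T_Partial[w [Uw _] ->]; exact: Partial_normalizer_B. Qed.

Lemma T_normalizer_A g : T g -> normalizer A g.
Proof.
have H g' : T g' -> forall h, A h -> A (h ^ g').
  move=> Tg' _ [c [v [Bc [Vv ->]]]]; rewrite wmulE conjMg.
  have -> : v ^ g' = v.
    by apply/conjg_fixP/eqP; apply/eqP/commgP; apply: commute_sym; apply: conj_commute; exact: T_V.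
  by apply: (subM sub_A); [apply: B_A; exact: normalizerJ (T_normalizer_B Tg') Bc | exact: V_A].
by move=> Tg; apply: normalizer_intro; apply: H => //; exact: (subV sub_T).
Qed.

Definition C : wset := setmul A T.
Lemma sub_C : is_subgroup C. Proof. exact: sub_setmul sub_A sub_T T_normalizer_A. Qed.
Lemma A_C g : A g -> C g.
Proof. by exists g, 1; split=> //; split; [exact: (sub1 sub_T) | rewrite wmulE mulg1]. Qed.
Lemma T_C g : T g -> C g.
Proof. by exists 1, g; split; [exact: (sub1 sub_A) | split=> //; rewrite wmulE mul1g]. Qed.

Lemma commutator_tau2 w : (Partial w)^-1 * Partial w ^ ta 2 = Partial w^-1 * Partial (w ^ ta 3).
Proof. by rewrite PartialV Partial_tau2. Qed.

(** The witness is w^-1 w^(tau 3). On even exponents [tau 3] is negation, and -2 = 1 in F_3. *)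
Lemma Partial_tau2_commutator w : Uh w -> exists2 u, Uh u &
  (Partial w)^-1 * Partial w ^ ta 2 = Partial u /\ forall n, ~~ odd n -> beta n u = beta n w.
Proof.
move=> Uw; have [_ U3] := Uh_tau23 Uw; have UV := UhV Uw.
exists (w^-1 * w ^ ta 3); first exact: UhM.
split; first by rewrite commutator_tau2 Partial_UhM.
move=> n en; rewrite beta_B ?(addfV sub_B (@beta_B n)); try exact: Uh_B.
have [_ ->] := beta_tau23 n Uw; rewrite (negbTE en).
by move: (beta n w); z3.
Qed.

Lemma normalizer_tau2_comm S g : is_subgroup S -> S (ta 2) -> normalizer S g -> S (g^-1 * g ^ ta 2).
Proof.
move=> sS S2 N; rewrite (_ : _ * _ = ((ta 2)^-1) ^ g * ta 2); last by gnorm.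
by apply: (subM sS) => //; apply: (normalizerJ N); exact: (subV sS).
Qed.
Lemma normalizer_tau1_comm S g : is_subgroup S -> S (ta 1) -> normalizer S g -> S (g^-1 * g ^ ta 1).
Proof.
move=> sS S2 N; rewrite (_ : _ * _ = ((ta 1)^-1) ^ g * ta 1); last by gnorm.
by apply: (subM sS) => //; apply: (normalizerJ N); exact: (subV sS).
Qed.

(** After removal of the factor in [A], the commutator of [Partial w] with [tau 2] lies in [A] and
    has the form [Partial u]. Parity puts it in [B], so u = 1, and the even exponents of w, being
    those of u, vanish. *)
Lemma normalizer_A g : normalizer A g <-> C g.
Proof.
split=> [Ng|[al [s [Aal [Ts ->]]]]]; last first.
  apply: (subM (sub_normalizer A)); last exact: T_normalizer_A.
  exact: normalizer_sub sub_A Aal.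
have [al [w [Aal Uw e]]] := normalizer_B (normalizer_A_B Ng).
exists al, (Partial w); split=> //; split=> //; apply/T_Partial; exists w => //; split=> //.
have NP : normalizer A (Partial w).
  by apply: (subMl (sub_normalizer A)) (normalizer_sub sub_A Aal) _; rewrite -e.
have [u Uu [eu bu]] := Partial_tau2_commutator Uw.
have := normalizer_tau2_comm sub_A (V_A V_tau2) NP; rewrite eu => Au.
have u1 : u = 1.
  apply: Partial_B_eq1 => //; apply: A_even_B => //.
  by rewrite sec_Partial; exact: even1.
by move=> n /bu <-; rewrite u1 beta1.
Qed.

(** * The third normalizer *)

Definition D : wset := setmul B T.
Lemma sub_D : is_subgroup D. Proof. exact: sub_setmul sub_B sub_T T_normalizer_B. Qed.
Lemma B_D g : B g -> D g.
Proof. by exists g, 1; split=> //; split; [exact: (sub1 sub_T) | rewrite wmulE mulg1]. Qed.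
Lemma T_D g : T g -> D g.
Proof. by exists 1, g; split; [exact: (sub1 sub_B) | split=> //; rewrite wmulE mul1g]. Qed.
Lemma D_C g : D g -> C g.
Proof. by move=> [c [s [Bc [Ts ->]]]]; exists c, s; split=> //; exact: B_A. Qed.

Lemma V_normalizer_D v : V v -> normalizer D v.
Proof.
move=> Vv; have H u : V u -> forall h, D h -> D (h ^ u).
  move=> Vu _ [c [s [Bc [Ts ->]]]]; rewrite wmulE conjMg [s ^ u]T_V //.
  by apply: (subM sub_D); [apply: B_D; exact: normalizerJ (V_B Vu) Bc | exact: T_D].
by apply: normalizer_intro; apply: H => //; rewrite V_inv.
Qed.

Lemma C_DV g : C g -> setmul D V g.
Proof.
move=> [_ [s [[c [v [Bc [Vv ->]]]] [Ts ->]]]]; exists (c * s), v; split; [|split=> //].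
  by apply: (subM sub_D); [exact: B_D | exact: T_D].
by rewrite !wmulE -!mulgA; congr (_ * _); apply: commute_sym; apply: conj_commute; exact: T_V.
Qed.

Lemma gen3_D : gen3 D.
Proof.
move=> K sK HK _ [c [s [Bc [Ts ->]]]]; apply: (subM sK).
  by apply: (gen3_B sK) Bc => h Bh; apply: HK; exact: B_D.
by apply: HK; [exact: T_D | move/T_Partial: Ts => [w [Uw _] ->]; exact: Partial_exp3].
Qed.

Lemma normalizer_C_D g : normalizer C g -> normalizer D g.
Proof.
apply: normalizer_gen3; [exact: sub_D | exact: gen3_D | exact: D_C |].
by move=> c /C_DV; exact: setmul_V_square sub_D V_normalizer_D _.
Qed.

Lemma B_sec_Partial w i : Uh w -> B (sec (Partial w) i).
Proof.
move=> Uw; have [Bw BV] := (Uh_B Uw, Uh_B (UhV Uw)).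
by move: i; apply: I3P; rewrite sec_Partial //; exact: (sub1 sub_B).
Qed.

Lemma beta_sec_Partial w n i : Uh w -> beta n (sec (Partial w) i) = (i * beta n w)%R.
Proof.
move=> Uw; move: i; apply: I3P; rewrite sec_Partial ?beta1 ?mul0r ?mul1r //.
by rewrite (addfV sub_B (@beta_B n) (Uh_B Uw)); move: (beta n w); z3.
Qed.

Lemma a_sec_Partial w i : Uh w -> a (sec (Partial w) i) = 0%R.
Proof.
move=> Uw; apply: Uh_a; move: i; apply: I3P; rewrite sec_Partial //; first exact: Uh1.
exact: UhV.
Qed.

Lemma E_Partial w : Uo w -> E (Partial w).
Proof.
move=> [Uw ew]; apply: (@progression_E _ 0%R 0%R) => [|i|i]; first exact: even1.
  by apply: even_B; exact: B_sec_Partial.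
by have := beta_sec_Partial 0 i Uw; rewrite ew // mulr0 add0r; exact.
Qed.

Lemma kappa_Partial w i : Uo w -> kappa (Partial w) i = 0%R.
Proof.
move=> [Uw ew]; rewrite kappaE !a_sec_Partial // subr0 addr0.
by have := beta_sec_Partial 0 i Uw; rewrite ew // mulr0; exact.
Qed.

(** A factor [Partial w] adds (j + b c) beta(w) to the exponents of section j: nothing at even
    levels, and a total of 0 over the three sections at every level. *)
Lemma D_spec d : D d -> [/\ forall j, B (sec d j), even (rt d), forall j, kappa d j = kappa d 0%R,
  forall n j, odd n -> beta n.+1 (sec d j) = beta n.+1 (sec d 0%R) &
  forall n, (beta n.+1 (sec d 0%R) + beta n.+1 (sec d 1%R) + beta n.+1 (sec d 2%:R%R))%R = 0%R].
Proof.
move=> [c [_ [Bc [/T_Partial[w Ow ->] ->]]]]; rewrite wmulE; have [Uw ew] := Ow.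
have ec := even_B Bc; have BP i := B_sec_Partial i Uw.
have bE n j : beta n.+1 (sec (c * Partial w) j) = (beta n.+2 c + (j + b c) * beta n.+1 w)%R.
  by rewrite secM rtE // beta_B ?beta_sec_Partial ?beta_sec //; exact: B_sec.
split.
- by move=> j; rewrite secM; apply: (subM sub_B) => //; exact: B_sec.
- by rewrite rtM mulg1.
- have kE j : kappa (c * Partial w) j = kappa c j.
    rewrite kappaM ?kappa_Partial ?addr0 //; [exact: B_E | exact: E_Partial | |].
      by move=> i; apply: B_E; exact: B_sec.
    by move=> i; apply: B_E.
  by move=> j; rewrite !kE; exact: kappa_const.
- by move=> n j on; rewrite !bE ew ?mulr0 //= on.
- by move=> n; rewrite !bE; move: (beta _ _) (beta _ _) (b c); z3.
Qed.

Lemma beta_JB n g h : B g -> B h -> beta n (g ^ h) = beta n g.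
Proof. by move=> Bg Bh; rewrite (addfJ sub_B (@beta_B n)). Qed.

(** Conjugation by [Partial y] sends gamma to gamma and x to x Delta(y), which determines the
    additive functions on conjugates of elements of Gamma. *)
Lemma A_xJ_exponents al y : A al -> Uh y ->
  [/\ b (x ^ (al * Partial y)) = b (x ^ al), a (gam ^ (al * Partial y)) = a (gam ^ al),
      a (x ^ (al * Partial y)) = a (x ^ al) &
      forall n, beta n.+1 (x ^ (al * Partial y)) = (b (x ^ al) * beta n y)%R].
Proof.
move=> Aal Uy; have Nal := A_normalizer_Gamma Aal.
have Gx := normalizerJ Nal Gamma_x; have Gg := normalizerJ Nal Gamma_gamma.
have NP := Partial_normalizer_B Uy; have UD := Uh_Delta Uy.
have fD f : additive_on B f -> forall h k, Gamma h -> Gamma k ->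
    f ((h * k) ^ Partial y) = (f (h ^ Partial y) + f (k ^ Partial y))%R.
  by move=> fB h k Gh Gk; rewrite conjMg fB //; apply: (normalizerJ NP); exact: Gamma_B.
have fE f z : additive_on B f -> Gamma z ->
    f (z ^ Partial y) = (a z * f gam + b z * (f x + f (Delta y)))%R.
  move=> fB Gz; rewrite (additive_Gamma (fD f fB) Gz) gamma_Partial // x_Partial //.
  by rewrite fB //; [exact: B_x | exact: Uh_B].
rewrite !conjgM; split=> [|||n]; rewrite fE //; try by [exact: a_B | exact: b_B | exact: beta_B].
- by rewrite b_gamma b_x b_Delta addr0 mulr0 add0r mulr1.
- by rewrite a_gamma a_x a_Delta addr0 mulr0 addr0 mulr1.
- by rewrite a_gamma a_x a_Delta addr0 mulr0 addr0 mulr1.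
- by rewrite betaS_gamma betaS_x beta_Delta mulr0 !add0r.
Qed.

Lemma Uo_mul w v : Uh w -> Uh v ->
  (forall n, ~~ odd n -> beta n w = beta n v^-1) -> Uo (w * v).
Proof.
move=> Uw Uv e; split=> [|n en]; first exact: UhM.
have [Bw Bv] := (Uh_B Uw, Uh_B Uv).
by rewrite beta_B // e // (addfV sub_B (@beta_B n)) // addNr.
Qed.

Lemma D_commutator_Uo g h (w : 'Z_3 -> W) : rt g = 1 -> (forall j, Uh (w j)) -> w 0%R = 1 ->
  (forall j, sec g j = h * w j) -> D (x ^ g) -> Uo (w 1%R * w 2%:R%R).
Proof.
move=> rg Uw w0 sg Dx; have [_ _ k2 b2 _] := D_spec Dx.
pose y (j : 'Z_3) := (w j)^-1 * w (j + 1)%R.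
have Uy j : Uh (y j) by apply: UhM => //; exact: UhV.
have sx j : sec (x ^ g) j = y j by rewrite sec_xJ // !sg invgM -mulgA mulKg.
have y0 : y 0%R = w 1%R by rewrite /y w0 invg1 mul1g add0r.
have y2 : y 2%:R%R = (w 2%:R%R)^-1.
  by rewrite /y (_ : 2%:R + 1 = 0)%R ?w0 ?mulg1 //; z3.
apply: Uo_mul => // -[_|n]; last first.
  by move/negPn => on; rewrite -y0 -y2 -!sx b2 // [RHS]b2.
by rewrite -y0 -y2; have := k2 2%:R%R; rewrite !kappaE !sx !(Uh_a (Uy _)) !subr0 !addr0.
Qed.

(** For odd n, [D_spec] equates [beta n.+1] on sections 0 and 1 of gamma^g. In the zero sum sections
    1 and 2 cancel, so section 0 vanishes, and with it section 1. *)
Lemma D_gammaJ g h (w : 'Z_3 -> W) : normalizer B h -> rt g = 1 -> (forall j, Uh (w j)) -> w 0%R = 1 ->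
  (forall j, sec g j = h * w j) -> D (gam ^ g) ->
  b (x ^ h) = a (gam ^ h) /\ forall n, odd n -> beta n.+1 (x ^ h) = 0%R.
Proof.
move=> Nh rg Uw w0 sg Dg; have [_ _ kg bg sumg] := D_spec Dg.
have Bx := normalizerJ Nh B_x; have Bg := normalizerJ Nh B_gamma.
have Bw j := Uh_B (Uw j).
have s0 : sec (gam ^ g) 0%R = gam ^ h by rewrite secJ1 // sg w0 mulg1.
have s1 : sec (gam ^ g) 1%R = (x ^ h) ^ w 1%R by rewrite secJ1 // sg conjgM.
have s2 : sec (gam ^ g) 2%:R%R = ((x ^ h) ^ w 2%:R%R)^-1 by rewrite secJ1 // sg conjgM !conjVg.
have BxJ j : B ((x ^ h) ^ w j) by exact: (subJ sub_B).
split.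
  have := kg 1%R; rewrite !kappaE add0r.
  have -> : (1 + 1)%R = 2%:R%R :> 'Z_3 by z3.
  have -> : (1 + 2%:R)%R = 0%R :> 'Z_3 by z3.
  rewrite add0r s0 s1 s2 (addfV sub_B a_B) // !(addfJ sub_B a_B Bx (Bw _)) (addfJ sub_B b_B Bx (Bw _)).
  by rewrite a_xJ // b_J_gamma; move: (b _) (a _); z3.
move=> n on; have := sumg n; have := bg n 1%R on.
rewrite s0 s1 s2 (addfV sub_B (@beta_B n.+1)) // !(beta_JB _ Bx (Bw _)).
by move: (beta _ _) (beta _ _); z3.
Qed.

Lemma Uh_tau2_fix y : Uh y -> (forall n, odd n -> beta n y = 0%R) -> y ^ ta 2 = y.
Proof.
move=> Uy oy; have [U2 _] := Uh_tau23 Uy; apply: Uh_eq => // n.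
by have [-> _] := beta_tau23 n Uy; case: ifP => // /oy ->; rewrite oppr0.
Qed.

Lemma D_of_C z : C z -> rt z = 1 -> even (rt (sec z 0%R)) -> D z.
Proof.
move=> Cz; apply: setmul_V_even (C_DV Cz) => h /D_spec[Bh eh _ _ _]; split=> //.
exact: even_B.
Qed.

Lemma normalizer_C_core g y (w : 'Z_3 -> W) : normalizer C g -> rt g = 1 -> Uh y ->
  (forall n, odd n -> beta n y = 0%R) -> (forall j, Uh (w j)) -> w 0%R = 1 -> Uo (w 1%R * w 2%:R%R) ->
  (forall j, sec g j = Partial y * w j) -> C g.
Proof.
move=> Ng rg Uy oy Uw w0 [Uw12 ew12] sg.
have C1 := normalizer_tau1_comm sub_C (A_C (V_A V_tau1)) Ng.
have s1 i : sec (g^-1 * g ^ ta 1) i = (w i)^-1 * (w (- i)%R)^-1.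
  rewrite secM secV rtV rg invg1 perm1 secJ_tau1 !sg conjMg Partial_tau1_fix // Uh_tau1 //.
  by rewrite invgM -mulgA mulKg.
have D1 : D (g^-1 * g ^ ta 1).
  apply: D_of_C => //; first by rewrite rtM rtJ1 // rtV rg invg1 mulg1.
  by rewrite s1 oppE w0 !invg1 mulg1; exact: even1.
have [_ _ _ _ sum1] := D_spec D1.
have UV j := UhV (Uw j).
(* The commutator with [tau 1] has sections 1, v, v with v = (w_1 w_2)^-1, so the zero sum kills the
   exponents of positive index; index 0 is even and covered by [Uo]. *)
have w12 : w 1%R * w 2%:R%R = 1.
  apply: Uh_eq1 => // -[|n]; first exact: ew12.
  have := sum1 n; rewrite !s1 !oppE w0 !invg1 mulg1 beta1 -!invgM.
  rewrite (Uh_commute (Uw 2%:R%R) (Uw 1%R)) !(addfV sub_B (@beta_B n.+1)); try exact: Uh_B.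
  by move: (beta _ _); z3.
have w2 : w 2%:R%R = (w 1%R)^-1 by rewrite -(mulg1_eq w12).
have gE : g = Delta (Partial y) * Partial (w 1%R).
  apply: Wext => [|j]; first by rewrite rg rtM mulg1.
  rewrite secM rt_Delta perm1 sec_Delta sg; congr (_ * _).
  by move: j; apply: I3P; rewrite sec_Partial.
have C2 := normalizer_tau2_comm sub_C (A_C (V_A V_tau2)) Ng.
have r2 : rt (g^-1 * g ^ ta 2) = 1 by rewrite rtM rtJ1 // rtV rg invg1 mulg1.
(* Both [tau 3] and inversion send [Partial y] to the same element, so section 0 of the commutator
   with [tau 2] is Partial(y)^-2 = Partial(y), and it must lie in [B]. *)
have y1 : y = 1.
  have s2 : sec (g^-1 * g ^ ta 2) 0%R = Partial y.
    rewrite secM secV rtV rg invg1 perm1 secJ_tau2 !sg w0 !mulg1 Partial_tau3.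
    rewrite conjVg Uh_tau2_fix // -PartialV.
    by rewrite -invgM -expg2 -(exp3V (Partial_exp3 Uy)) invgK.
  apply: Partial_B_eq1 => //; rewrite -s2.
  have [|Bs _ _ _ _] := @D_spec (g^-1 * g ^ ta 2); last exact: Bs.
  by apply: D_of_C => //; rewrite s2; exact: even1.
apply: T_C; apply/T_Partial; exists (w 1%R); last by rewrite gE y1 Partial1 Delta1 mul1g.
split=> //; rewrite gE y1 Partial1 Delta1 mul1g in C2 r2.
have [u Uu [eu bu]] := Partial_tau2_commutator (Uw 1%R).
rewrite eu in C2 r2.
have [|_ _ ku bsu _] := @D_spec (Partial u).
  by apply: D_of_C => //; rewrite sec_Partial; exact: even1.
move=> n en; rewrite -bu //; case: n en => [_|n en].
  have := ku 1%R; rewrite !kappaE !a_sec_Partial // sec_Partial1 sec_Partial0 b1 !subr0 !addr0.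
  exact.
by move/negPn: en => on; have := bsu n 1%R on; rewrite sec_Partial1 sec_Partial0 beta1.
Qed.

Lemma normalizer_C_root1 g : normalizer C g -> rt g = 1 -> C g.
Proof.
move=> Ng rg; have ND := normalizer_C_D Ng; have sN := sub_normalizer C.
have [Bs _ _ _ _] := D_spec (normalizerJ ND (B_D B_x)).
have Bd j : B ((sec g j)^-1 * sec g (j + 1)%R) by rewrite -sec_xJ.
have [k [n [w [Gk rk Uw w0 sgk]]]] := reduce_sections rg (B_diff Bd 0%R).
have Ck : C k by apply: A_C; apply: B_A; exact: Gamma_B.
apply: (subMr sub_C (h := k)) (Ck) _.
have rgk : rt (g * k) = 1 by rewrite rtM rg rk mulg1.
have Ngk : normalizer C (g * k).
  by apply: (subM sN) => //; exact: normalizer_sub sub_C Ck.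
have NDgk := normalizer_C_D Ngk.
(* From here [g] is the reduced element, with sections [h * w j]. *)
move: (g * k) (sec g 0%R * x ^+ n) rgk sgk Ngk NDgk => {}g h {Ng rg ND Bs Bd Gk rk Ck k n} rg sg Ng ND.
have Nh : normalizer B h.
  have <- : sec g 0%R = h by rewrite sg w0 mulg1.
  apply: proj_normalizer ND rg _ _ => [s /D_spec[Bs _ _ _ _] //|y /(B_proj 0%R)[s [Bs rs se]]].
  by exists s; split=> //; exact: B_D.
have Ow := D_commutator_Uo rg Uw w0 sg (normalizerJ ND (B_D B_x)).
have [bE dE] := D_gammaJ Nh rg Uw w0 sg (normalizerJ ND (B_D B_gamma)).
have [al [y [Aal Uy hE]]] := normalizer_B Nh.
have Nal := A_normalizer_Gamma Aal.
have [e1 e2 e3 e4] := A_xJ_exponents Aal Uy.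
have oy n : odd n -> beta n y = 0%R.
  move=> on; have := dE n on; rewrite hE e4; have := b_xJ_neq0 Nal.
  by move: (b _) (beta _ _); do 2!(apply: I3P).
(* The exponent conditions on [h] pass to [al], and dividing by [Delta al] leaves the sections
   Partial(y) w_j of [normalizer_C_core]. *)
have CD : C (Delta al).
  apply: A_C; have [||c Bc alE] := normalizer_Gamma_cases Nal.
  - by rewrite -e3 -hE a_xJ.
  - by rewrite -e1 -e2 -hE.
  - exact: A_Delta_cases Bc alE.
have CDV := subV sub_C CD.
apply: (subMl sub_C) (CDV) _; apply: (@normalizer_C_core _ y w) => //.
- by apply: (subM sN) => //; exact: normalizer_sub sub_C CDV.
- by rewrite rtM rg mulg1 rtV rt_Delta invg1.
- by move=> j; rewrite secM secV rtV rt_Delta invg1 perm1 sec_Delta sg hE -!mulgA mulKg.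
Qed.

Lemma normalizer_C g : normalizer C g <-> C g.
Proof.
split=> [Ng|Cg]; last exact: normalizer_sub sub_C Cg.
have [s [n [s1 rg]]] := root_reduction g.
have Cs : C s by apply: A_C; apply: V_A; exact: V_1_tau1.
have Cx : C (x ^+ n) by apply: A_C; apply: B_A; apply: Gamma_B; exact: Gamma_xX.
have sN := sub_normalizer C.
apply: (subMr sub_C) (Cx) _; apply: (subMr sub_C) (Cs) _; apply: normalizer_C_root1 rg.
apply: (subM sN); last exact: normalizer_sub sub_C Cs.
by apply: (subM sN) => //; exact: normalizer_sub sub_C Cx.
Qed.

(** * The tower, the properties of T and the height *)

Lemma wset_ext (H K : wset) : seteq H K -> H = K.
Proof. by move=> e; apply/funext => g; apply/propext; exact: e. Qed.

Lemma AutTower1 : AutTower 1 = A.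
Proof. by apply: wset_ext => g; exact: normalizer_Gamma. Qed.
Lemma AutTower2 : AutTower 2 = C.
Proof. by apply: wset_ext => g; rewrite -normalizer_A -AutTower1. Qed.
Lemma AutTower3 : AutTower 3 = C.
Proof. by apply: wset_ext => g; rewrite -normalizer_C -AutTower2. Qed.

Lemma T_commute g h : T g -> T h -> commute g h.
Proof. by move=> /T_Partial[w [Uw _] ->] /T_Partial[v [Uv _] ->]; exact: Partial_UhC. Qed.

Lemma A_T_trivial g : A g -> T g -> g = 1.
Proof.
move=> Ag /T_Partial[w [Uw _] gE]; have Bg : B g.
  by apply: A_even_B => //; rewrite gE // sec_Partial; exact: even1.
by rewrite gE (Partial_B_eq1 Uw) ?Partial1 // -gE.
Qed.

(** The generators are pairwise distinct, since the exponents [beta] of section 1 tell them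
    apart. *)
Lemma T_infinite : ~ finite_set T.
Proof.
move=> [l Tl]; pose f n := Partial (xn (2 * n + 1)).
have memP (g : W) : inlist g l -> g \in (l : seq W).
  by elim: (l) => //= h l' IH [->|/IH]; rewrite inE ?eqxx // => ->; rewrite orbT.
have f_inj : injective f.
  move=> m n /(congr1 (fun g => beta (2 * m + 1) (sec g 1%R))); rewrite /f !sec_Partial !beta_xn eqxx.
  by case: eqP => [|_ /eqP]; [lia | ].
have uf : uniq (map f (iota 0 (size l).+1)) by rewrite map_inj_uniq ?iota_uniq.
have : size (map f (iota 0 (size l).+1)) <= size l.
  apply: uniq_leq_size => // _ /mapP[n _ ->]; apply: memP; apply: Tl; apply: mem_gen; by exists n.
by rewrite size_map size_iota ltnn.
Qed.

Lemma centralizes_T_U : centralizes T U.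
Proof.
move=> g h /T_Partial[w [Uw _] ->] /U_Delta[u Uu ->]; apply: commute_sym.
by apply: conj_commute; exact: Delta_Partial.
Qed.

Lemma centralizes_T_V : centralizes T V.
Proof. by move=> g v Tg Vv; apply: conj_commute; exact: T_V. Qed.

Lemma split_ext_A_T : split_ext C A T.
Proof.
split; [split; first exact: A_C | split; [exact: T_C | split=> //; exact: A_T_trivial]].
move=> g h Cg Ah; rewrite !wmulE winvE -mulgA -/(h ^ g).
by apply: normalizerJ Ah; exact/normalizer_A.
Qed.

Lemma Gamma_not_A : ~ seteq Gamma A.
Proof.
move=> e; have : Gamma (xn 1) by apply/e; apply: B_A; exact: B_xn.
by move/(@beta_Gamma 0); rewrite beta_xn; z3.
Qed.

Lemma A_not_C : ~ seteq A C.
Proof.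
move=> e; have Tx : T (Partial (xn 1)) by apply/T_Partial; exists (xn 1) => //; exact: (Uo_xn 0).
have /A_T_trivial/(_ Tx) : A (Partial (xn 1)) by apply/e; exact: T_C.
move/(congr1 (fun g => beta 1 (sec g 1%R))); rewrite sec_Partial1 beta_xn sec1 beta1; z3.
Qed.

Local Close Scope group_scope.

Theorem theorem5p3 :
  ((* T is an infinite elementary abelian 3-group *)
   centralizes T T /\ (forall g, T g -> wmul g (wmul g g) = wone) /\
   ~ finite_set T) /\
  split_ext (AutTower 2) (AutTower 1) T /\
  centralizes T U /\ centralizes T V /\
  seteq (AutTower 3) (AutTower 2) /\
  height_is 2.
Proof.
rewrite /height_is AutTower1 AutTower3 AutTower2.
split; last split; last split; last split; last split.
- split; [exact: T_commute | split; last exact: T_infinite].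
  move=> g /T_Partial[w [Uw _] ->].
  by have := Partial_exp3 Uw; rewrite !expgS expg0 mulg1.
- exact: split_ext_A_T.
- exact: centralizes_T_U.
- exact: centralizes_T_V.
- by [].
- split=> // -[|[|//]] _; first by rewrite AutTower1; exact: Gamma_not_A.
  by rewrite AutTower1 AutTower2; exact: A_not_C.
Qed.
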